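(* Let $A \in \mathrm{POTIME}[t(n)^{1-\delta},\mathcal Q]$ (respectively $\mathrm{PONTIME}[t(n)^{1-\delta},\mathcal Q]$) for some $\delta>0$ and some explicit polynomial family $\mathcal Q$. Then $A$ is not $t(n)$-SETH-hard under POSETH (respectively PONSETH).
   Context: A family $\mathcal Q=\{Q_n\}$ of polynomials over $\mathbb Z$ is explicit if there is a constant $\Delta$ such that $Q_n$ has degree at most $\Delta$, coefficients of absolute value $O(n^\Delta)$, all computable in time $O(n^\Delta)$. $\mathrm{POTIME}[t,\mathcal Q]$ (resp. $\mathrm{PONTIME}[t,\mathcal Q]$) is the class of problems solvable in deterministic (resp. nondeterministic) time $t(n)$ with oracle calls to $\mathcal Q$, a call on integers $a_1,\dots,a_s$ with $|a_i|=2^{s^{o(1)}}$ returning $Q_s(a_1,\dots,a_s)$ in time $s$. $k$-SAT: decide if a $k$-CNF formula on $n$ variables is satisfiable; $k$-TAUT: decide if it is unsatisfiable. POSETH (resp. PONSETH): for every $\epsilon>0$ and every explicit $\mathcal Q$ there is $k$ with $k$-TAUT $\notin\mathrm{POTIME}[2^{(1-\epsilon)n},\mathcal Q]$ (resp. $\notin\mathrm{PONTIME}[2^{(1-\epsilon)n},\mathcal Q]$). Fine-grained reduction $(P,p(n))\le_\delta(Q,q(n))$: for every $\varepsilon>0$ and $\delta=\delta(\varepsilon)>0$ there is an algorithm for $P$ with oracle to $Q$, a constant $d$, and $t(n)$ such that on size-$n$ inputs it runs in time $\le d\,p(n)^{1-\delta}$, produces adaptively at most $t(n)$ instances of $Q$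 of sizes $n_i$ with $\sum_i q(n_i)^{1-\varepsilon}\le d\,p(n)^{1-\delta}$. A problem $P$ is $t(n)$-SETH-hard if there is $\delta\colon\mathbb R_{>0}\to\mathbb R_{>0}$ such that for every $k$, $(k\text{-SAT},2^n)\le_\delta (P,t(n))$.
   Formalization: PONTIME is read two-sidedly: every path answers correctly or gives up, and some path answers. With one-sided acceptance the claim fails under PONSETH: SAT is 2^n-SETH-hard yet easy nondeterministically. PONSETH itself is unaffected. *)

(* Defs.v *)
From mathcomp Require Import all_boot all_order all_algebra.
From mathcomp Require Import boolp reals exp.
From mathcomp Require Import mpoly.

Set Implicit Arguments.
Unset Strict Implicit.
Unset Printing Implicit Defensive.

Import Order.TTheory GRing.Theory Num.Theory.
Local Open Scope ring_scope.

(******************************************************************************)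
(* Machine model: a random access machine over the integers with the          *)
(* logarithmic cost criterion, presented as a structured language.            *)
(* An input word w is laid out in memory as                                   *)
(*    memory 0 = size w,  memory (i+1) = w_i,  every other cell = 0           *)
(* (so negative addresses are free scratch cells), and the result of a run is *)
(* the final content of cell 0.                                               *)
(* Oracle queries are written item by item on a write-only tape; Ask stores   *)
(* the oracle's answer to the word on the tape in a cell and erases the tape. *)
(* Nondeterminism is an infinite stream of guess bits, read one by one: the   *)
(* computation paths of a program are its runs on the various streams.        *)
(******************************************************************************)

Definition word := seq int.

Definition bitlen (z : int) : nat := (trunc_log 2 `|z|%N).+1.

Inductive arith := Add | Sub | Mul | Div.

Definition arith_eval (o : arith) (x y : int) : int :=
  match o with
  | Add => x + y
  | Sub => x - y
  | Mul => x * y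
  | Div => (x %/ y)%Z
  end.

(* x, y, z are fixed addresses; [a] stands for the content of cell a. *)
Inductive instr :=
| Const of int & int                (* Const x c     : [x] := c            *)
| Arith of arith & int & int & int  (* Arith o x y z : [x] := [y] o [z]    *)
| Fetch of int & int                (* Fetch x y     : [x] := [[y]]        *)
| Store of int & int                (* Store x y     : [[x]] := [y]        *)
| Guess of int                      (* Guess x       : [x] := guessed bit  *)
| Push of int                       (* Push x        : append [x] to tape  *)
| Erase                             (* Erase         : erase the tape      *)
| Ask of int.                       (* Ask x         : [x] := oracle(tape) *)

Inductive prog :=
| Instr of instr
| Then of prog & prog
| IfPos of int & prog & prog      (* branch on 0 < [x] *)
| WhilePos of int & prog.         (* loop while 0 < [x] *)

Fixpoint deterministic (p : prog) : bool :=
  match p with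
  | Instr (Guess _) => false
  | Instr _ => true
  | Then p1 p2 | IfPos _ p1 p2 => deterministic p1 && deterministic p2
  | WhilePos _ p1 => deterministic p1
  end.

Record state := State {
  memory : int -> int;
  tape : word;
  guesses : nat -> bool;
  clock : nat;
  queries : seq word
}.

Definition init (w : word) (g : nat -> bool) : state :=
  State (fun a : int => match a with
                        | Posz 0 => (size w)%:Z
                        | Posz i.+1 => w`_i
                        | Negz _ => 0
                        end)
        [::] g 0%N [::].

Definition write (m : int -> int) (a v : int) : int -> int :=
  fun b => if b == a then v else m b.

Definition tick (c : nat) (s : state) : state :=
  State (memory s) (tape s) (guesses s) (clock s + c)%N (queries s).

Definition set_mem (a v : int) (s : state) : state :=
  State (write (memory s) a v) (tape s) (guesses s) (clock s) (queries s).

(* Every item that is read, computed from, or used as an indirect address is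
   charged its bit length; an oracle call is charged the length of the query
   (plus one, so that the empty query is not free). *)
Definition instr_cost (i : instr) (s : state) : nat :=
  let m := memory s in
  match i with
  | Const _ c => bitlen c
  | Arith _ _ y z => bitlen (m y) + bitlen (m z)
  | Fetch _ y => bitlen (m y) + bitlen (m (m y))
  | Store x y => bitlen (m x) + bitlen (m y)
  | Guess _ => 1
  | Push x => bitlen (m x)
  | Erase => 1
  | Ask _ => (size (tape s)).+1
  end%N.

Definition instr_effect (O : word -> int) (i : instr) (s : state) : state :=
  let m := memory s in
  match i with
  | Const x c => set_mem x c s
  | Arith o x y z => set_mem x (arith_eval o (m y) (m z)) s
  | Fetch x y => set_mem x (m (m y)) s
  | Store x y => set_mem (m x) (m y) s
  | Guess x => State (write m x (guesses s 0%N)%:Z) (tape s)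
                     (fun i => guesses s i.+1) (clock s) (queries s)
  | Push x => State m (rcons (tape s) (m x)) (guesses s) (clock s) (queries s)
  | Erase => State m [::] (guesses s) (clock s) (queries s)
  | Ask x => State (write m x (O (tape s))) [::] (guesses s) (clock s)
                   (rcons (queries s) (tape s))
  end.

Inductive exec (O : word -> int) : prog -> state -> state -> Prop :=
| ExecInstr i s :
    exec O (Instr i) s (tick (instr_cost i s) (instr_effect O i s))
| ExecThen p1 p2 s1 s2 s3 :
    exec O p1 s1 s2 -> exec O p2 s2 s3 -> exec O (Then p1 p2) s1 s3
| ExecIfTrue x p1 p2 s1 s2 :
    0 < memory s1 x -> exec O p1 (tick (bitlen (memory s1 x)) s1) s2 ->
    exec O (IfPos x p1 p2) s1 s2
| ExecIfFalse x p1 p2 s1 s2 :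
    memory s1 x <= 0 -> exec O p2 (tick (bitlen (memory s1 x)) s1) s2 ->
    exec O (IfPos x p1 p2) s1 s2
| ExecWhileStop x p s :
    memory s x <= 0 ->
    exec O (WhilePos x p) s (tick (bitlen (memory s x)) s)
| ExecWhileStep x p s1 s2 s3 :
    0 < memory s1 x -> exec O p (tick (bitlen (memory s1 x)) s1) s2 ->
    exec O (WhilePos x p) s2 s3 ->
    exec O (WhilePos x p) s1 s3.

Definition result (s : state) : int := memory s 0.

(******************************************************************************)
(* Decision problems, with an arbitrary size parameter (such as the number of *)
(* variables of a formula). Only the words satisfying [instance] are inputs.  *)
(******************************************************************************)

Record problem := Problem {
  instance : word -> Prop;
  yes : word -> Prop;
  psize : word -> nat
}.

Definition answer (P : problem) (w : word) : int := `[< yes P w >]%:Z.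

(* Formulas in the DIMACS style: the literals are i and - i for 1 <= i <= n,
   a clause is a list of literals, a formula a repetition-free list of clauses.
   (Were repetitions allowed, the length of the input would not be bounded by
   a function of k and n.) *)
Definition clause := seq int.

Definition kcnf (k n : nat) (phi : seq clause) : bool :=
  uniq phi &&
  all (fun c : clause =>
         (size c <= k)%N && all (fun l : int => 0 < `|l|%N <= n)%N c) phi.

Definition lit_true (a : nat -> bool) (l : int) : bool :=
  if 0 < l then a `|l|%N else ~~ a `|l|%N.

Definition satisfiable (phi : seq clause) : Prop :=
  exists a : nat -> bool, all (has (lit_true a)) phi.

(* Clauses are terminated by 0. *)
Definition encode_cnf (n : nat) (phi : seq clause) : word :=
  n%:Z :: flatten [seq rcons c 0 | c <- phi].

Definition num_vars (w : word) : nat := `|head (0 : int) w|%N.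

Definition kSAT (k : nat) : problem := {|
  instance := fun w => exists n phi, kcnf k n phi /\ w = encode_cnf n phi;
  yes := fun w => exists n phi,
    [/\ kcnf k n phi, w = encode_cnf n phi & satisfiable phi];
  psize := num_vars |}.

Definition kTAUT (k : nat) : problem := {|
  instance := fun w => exists n phi, kcnf k n phi /\ w = encode_cnf n phi;
  yes := fun w => exists n phi,
    [/\ kcnf k n phi, w = encode_cnf n phi & ~ satisfiable phi];
  psize := num_vars |}.

(******************************************************************************)
(* Explicit polynomial families and computations with oracle calls to them.   *)
(******************************************************************************)

Definition poly_family := forall n : nat, {mpoly int[n]}.

(* The coefficient of a monomial is computed, without any help of an oracle,
   from n and the exponent vector of the monomial. *)
Definition explicit (Q : poly_family) : Prop :=
  exists D C : nat, exists p : prog,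
  [/\ deterministic p,
      forall n, (0 < n)%N -> (msize (Q n) <= D.+1)%N,
      forall n (m : 'X_{1..n}), (0 < n)%N ->
        (`|(Q n)@_m|%N <= C * n ^ D)%N
    & forall n (m : 'X_{1..n}) g, (0 < n)%N -> (mdeg m <= D)%N ->
        exists s, [/\ exec (fun=> 0) p
                        (init (n%:Z :: [seq (e : nat)%:Z | e <- m]) g) s,
                      result s = (Q n)@_m
                    & (clock s <= C * n ^ D)%N]].

Definition poly_oracle (Q : poly_family) (w : word) : int :=
  (Q (size w)).@[fun i : 'I_(size w) => w`_i].

Section Classes.
Variable R : realType.
Implicit Types (P A : problem) (Q : poly_family) (t : nat -> R).

(* b s = s ^ o(1) *)
Definition subpolynomial (b : nat -> nat) : Prop :=
  forall eta : R, 0 < eta -> exists N : nat, forall s : nat, (N <= s)%N ->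
    (b s)%:R <= s%:R `^ eta.

Definition legal_query (b : nat -> nat) (w : word) : Prop :=
  forall a : int, a \in w -> (`|a|%N <= 2 ^ b (size w))%N.

(* Time O(t n) on inputs of size n; max(1, t n) bounds the time from below by
   a constant, as no computation takes time 0. *)
Definition in_time (c : R) t (P : problem) (w : word) (s : state) : Prop :=
  (clock s)%:R <= c * Num.max 1 (t (psize P w)).

Definition POTIME t Q P : Prop :=
  exists (p : prog) (c : R) (b : nat -> nat),
  [/\ deterministic p, subpolynomial b
    & forall w g, instance P w -> exists s,
        [/\ exec (poly_oracle Q) p (init w g) s,
            in_time c t P w s,
            forall v, v \in queries s -> legal_query b v
          & result s = answer P w]].

(* A nondeterministic algorithm solves P if every computation path either
   returns the right answer (0 or 1) or gives up (any other result), and some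
   path returns the right answer. One-sided acceptance of A would not suffice:
   the oracle of a reduction also has to be answered on no-instances, and SAT
   is SETH-hard although it is easy for one-sided nondeterminism. *)
Definition PONTIME t Q P : Prop :=
  exists (p : prog) (c : R) (b : nat -> nat),
  [/\ subpolynomial b,
      forall w g, instance P w -> exists s,
        [/\ exec (poly_oracle Q) p (init w g) s,
            in_time c t P w s,
            forall v, v \in queries s -> legal_query b v
          & result s \in [:: 0; 1] -> result s = answer P w]
    & forall w, instance P w -> exists g s,
        exec (poly_oracle Q) p (init w g) s /\ result s = answer P w].

Definition POSETH : Prop :=
  forall (eps : R) Q, 0 < eps -> explicit Q -> exists k : nat,
    ~ POTIME (fun n => 2 `^ ((1 - eps) * n%:R)) Q (kTAUT k).

Definition PONSETH : Prop :=
  forall (eps : R) Q, 0 < eps -> explicit Q -> exists k : nat,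
    ~ PONTIME (fun n => 2 `^ ((1 - eps) * n%:R)) Q (kTAUT k).

Definition fg_reduces (delta : R -> R) P (p : nat -> R) A (q : nat -> R) :
    Prop :=
  forall eps : R, 0 < eps ->
  exists (r : prog) (d : R) (t : nat -> nat), deterministic r /\
    forall w g, instance P w ->
    let n := psize P w in
    exists s,
    [/\ exec (answer A) r (init w g) s,
        result s = answer P w,
        (clock s)%:R <= d * p n `^ (1 - delta eps),
        (size (queries s) <= t n)%N /\
          (forall v, v \in queries s -> instance A v)
      & \sum_(v <- queries s) q (psize A v) `^ (1 - eps)
          <= d * p n `^ (1 - delta eps)].

Definition SETH_hard t A : Prop :=
  exists delta : R -> R, (forall eps, 0 < eps -> 0 < delta eps) /\
    forall k : nat, fg_reduces delta (kSAT k) (fun n => 2 ^+ n) A t.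

End Classes.

Arguments POSETH R : clear implicits.
Arguments PONSETH R : clear implicits.

(* Main.v *)
Require Import Defs.
From mathcomp Require Import all_boot all_order all_algebra.
From mathcomp Require Import reals exp.
From mathcomp Require Import boolp mpoly.
From mathcomp Require Import zify ring lra.
Import Order.TTheory GRing.Theory Num.Theory.
Local Open Scope ring_scope.

Set Implicit Arguments.
Unset Strict Implicit.
Unset Printing Implicit Defensive.

(** An algorithm for k-TAUT is obtained from a reduction r of k-SAT to A by
    running an algorithm q for A at every query of r and negating the answer.
    One machine has to hold both memories, and that of q has to be blank at
    each query: a cell of q carries the number of the query that wrote it last,
    and is read as 0 when this number is outdated.  With T the running time of
    r, all the bookkeeping involves integers of O(log T) bits, so a simulated
    run costs a factor O(log T) = O(n), which is absorbed by halving the saving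
    in the exponent.  When a nondeterministic path of q gives up, so does the
    whole simulation; here the result of q may be an oracle answer not read so
    far, but explicit polynomials have short values at legal queries.  *)

(** One simulation theorem serves both classes: on every stream of guesses the composed program
    answers correctly or gives up, and on some stream it answers correctly. A deterministic program
    runs alike on all streams, so for it the good stream is any stream. Once a run of q has given
    up, r cannot be continued with an invented answer: it might then loop forever or ask words that
    are not instances of A. Hence a flag is tested inside every sequence and at every turn of a
    loop. The reduction is taken at eps = delta, the saving of q. The total time of the inner runs
    is then governed by the sum that the reduction bounds, up to a constant, by 2^((1 - e) n), where
    e is its own saving at delta. As the time allowed to q is at least a constant, whatever t is,
    the number of queries is added to this sum; it is at most the running time of r. *)

Lemma bitlen_gt0 z : (0 < bitlen z)%N. Proof. by []. Qed.

Lemma ltn_exp_bitlen z : (`|z| < 2 ^ bitlen z)%N.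
Proof. exact: trunc_log_ltn. Qed.

Lemma bitlen_le z k : (0 < k)%N -> (`|z| < 2 ^ k)%N -> (bitlen z <= k)%N.
Proof.
move=> k_gt0 z_lt; rewrite /bitlen; case: (posnP `|z|%N) => [->|z_gt0].
  by rewrite trunc_log0.
rewrite -(ltn_exp2l _ _ (isT : 1 < 2)%N); apply: leq_ltn_trans z_lt.
exact: trunc_logP.
Qed.

Lemma leq_bitlen y z : (`|y| <= `|z|)%N -> (bitlen y <= bitlen z)%N.
Proof.
by move=> le_yz; apply: bitlen_le => //; apply: leq_ltn_trans (ltn_exp_bitlen z).
Qed.

Lemma bitlen_nat (m n : nat) : (m <= n)%N -> (bitlen m%:Z <= bitlen n%:Z)%N.
Proof. by move=> le_mn; apply: leq_bitlen. Qed.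

Lemma absz_add_bitlen (x y z : int) : (`|z| <= `|x| + `|y|)%N ->
  (bitlen z <= bitlen x + bitlen y)%N.
Proof.
move=> le_z; apply: bitlen_le => //; rewrite expnD.
have lt_x := ltn_exp_bitlen x; have lt_y := ltn_exp_bitlen y.
(* For X, Y >= 2 the sum X + Y is at most X * Y. *)
have : (2 <= 2 ^ bitlen x)%N by rewrite (leq_pexp2l (isT : 0 < 2)%N (bitlen_gt0 x)).
have : (2 <= 2 ^ bitlen y)%N by rewrite (leq_pexp2l (isT : 0 < 2)%N (bitlen_gt0 y)).
move: lt_x lt_y le_z; move: (2 ^ bitlen x)%N (2 ^ bitlen y)%N => X Y; nia.
Qed.

(** The right side is exactly the charge of [Arith]: a computed value is never longer than the time
    spent on it. *)
Lemma bitlen_arith o x y : (bitlen (arith_eval o x y) <= bitlen x + bitlen y)%N.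
Proof.
case: o => /=.
- by apply: absz_add_bitlen; lia.
- by apply: absz_add_bitlen; lia.
- apply: bitlen_le => //; rewrite abszM expnD.
  by rewrite ltn_mul // ltn_exp_bitlen.
apply: leq_trans (leq_addr _ _); apply: leq_bitlen.
have := lez_div x y; lia.
Qed.

Lemma write_same m a v : write m a v a = v.
Proof. by rewrite /write eqxx. Qed.

Lemma write_other m a v b : b <> a -> write m a v b = m b.
Proof. by move=> /eqP ne; rewrite /write (negbTE ne). Qed.

(** * Runs of programs *)

(** All choice lies in the guess stream of the initial state. This identifies the run given by
    soundness with the one promised by completeness when their streams agree. *)
Lemma exec_functional O p s s1 s2 : exec O p s s1 -> exec O p s s2 -> s1 = s2.
Proof.
move=> run1; elim: run1 s2 => {p s s1}.
- by move=> i s s2 run; inversion run.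
- move=> p1 p2 s1 s2 s3 _ IH1 _ IH2 s run; inversion run; subst.
  by apply: IH2; rewrite (IH1 _ ltac:(eassumption)).
- move=> x p1 p2 s1 s2 x_gt0 _ IH s run; inversion run; subst; first exact: IH.
  by lia.
- move=> x p1 p2 s1 s2 x_le0 _ IH s run; inversion run; subst; last exact: IH.
  by lia.
- by move=> x p s x_le0 s2 run; inversion run; subst => //; lia.
move=> x p s1 s2 s3 x_gt0 _ IH1 _ IH2 s run; inversion run; subst; first by lia.
by apply: IH2; rewrite (IH1 _ ltac:(eassumption)).
Qed.

Definition reguess s g := State (memory s) (tape s) g (clock s) (queries s).

(* Backwards in time: the guesses g2 left over at the end determine a stream
   to start from, so prescribed choices of successive runs can be chained. *)
Lemma exec_reguess O p s1 s2 : exec O p s1 s2 -> forall g2, exists g1,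
  (deterministic p -> g1 = g2) /\ exec O p (reguess s1 g1) (reguess s2 g2).
Proof.
elim=> {p s1 s2}.
- case=> [x c|o x y z|x y|x y|x|x||x] s g2;
    try by exists g2; split => //; apply: (ExecInstr _ _ (reguess s g2)).
  (* The bit actually read is put in front of the prescribed stream. *)
  exists (fun i => if i is j.+1 then g2 j else guesses s 0%N); split => //.
  exact: (ExecInstr _ _ (reguess s _)).
- move=> p1 p2 s1 s2 s3 _ IH1 _ IH2 g3.
  have [g2 [d2 run2]] := IH2 g3; have [g1 [d1 run1]] := IH1 g2.
  exists g1; split; last exact: ExecThen run1 run2.
  by move=> /= /andP[/d1 -> /d2 ->].
- move=> x p1 p2 s1 s2 x_gt0 _ IH g2; have [g1 [d1 run1]] := IH g2.
  by exists g1; split; [move=> /= /andP[/d1]|apply: ExecIfTrue].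
- move=> x p1 p2 s1 s2 x_le0 _ IH g2; have [g1 [d1 run1]] := IH g2.
  by exists g1; split; [move=> /= /andP[_ /d1]|apply: ExecIfFalse].
- move=> x p s x_le0 g2; exists g2; split => //.
  exact: (ExecWhileStop _ _ (s := reguess s g2)).
move=> x p s1 s2 s3 x_gt0 _ IH1 _ IH2 g3.
have [g2 [d2 run2]] := IH2 g3; have [g1 [d1 run1]] := IH1 g2.
exists g1; split; last exact:
  (@ExecWhileStep O x p (reguess s1 g1) (reguess s2 g2) _ x_gt0 run1 run2).
by move=> /= d; rewrite d1 // d2.
Qed.

Lemma instr_cost_gt0 i s : (0 < instr_cost i s)%N.
Proof. by case: i => *; rewrite //= addn_gt0. Qed.

Lemma exec_clock O p s1 s2 : exec O p s1 s2 -> (clock s1 < clock s2)%N.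
Proof.
elim=> {p s1 s2} //=.
- move=> i s; have -> : clock (instr_effect O i s) = clock s by case: i.
  by have := instr_cost_gt0 i s; lia.
- lia.
- move=> *; lia.
- move=> *; lia.
- move=> x p s _; have := bitlen_gt0 (memory s x); lia.
move=> *; lia.
Qed.

Lemma exec_queries O p s1 s2 : exec O p s1 s2 ->
  {subset queries s1 <= queries s2}.
Proof.
elim=> {p s1 s2} //=.
- by move=> i s v; case: i => //= _; rewrite mem_rcons inE orbC => ->.
- by move=> p1 p2 s1 s2 s3 _ s12 _ s23 v /s12 /s23.
- by move=> x _ s _ v.
by move=> x p s1 s2 s3 _ _ s12 _ s23 v /s12 /s23.
Qed.

(** Even an empty query costs one unit of time. This pays for the 1 in the maximum of [in_time],
    once per query. *)
Lemma exec_size_queries O p s1 s2 : exec O p s1 s2 ->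
  (size (queries s2) + clock s1 <= size (queries s1) + clock s2)%N.
Proof.
elim=> {p s1 s2} //=.
- case=> [x c|o x y z|x y|x y|x|x||x] s /=; rewrite ?size_rcons; lia.
- lia.
- move=> *; lia.
- move=> *; lia.
- move=> *; lia.
move=> *; lia.
Qed.

(** An instruction either leaves the cell alone or writes a value of length at most K times its
    charge: copied and computed values are charged in full, and oracle answers are linear in the
    charged query. *)
Lemma exec_bitlen O K p s1 s2 : (0 < K)%N -> exec O p s1 s2 ->
  (forall v, v \in queries s2 -> (bitlen (O v) <= K * (size v).+1)%N) ->
  forall a, (bitlen (memory s2 a) + K * clock s1
             <= bitlen (memory s1 a) + K * clock s2)%N.
Proof.
move=> K_gt0; elim=> {p s1 s2}.
- move=> i s oracle_small a.
  have write_small m x v c : (bitlen v <= K * c)%N -> (0 < c)%N ->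
      (bitlen (write m x v a) + K * clock s
       <= bitlen (m a) + K * (clock s + c))%N.
    by rewrite /write; case: eqP => _; have := bitlen_gt0 (m a); nia.
  have keep c : (bitlen (memory s a) + K * clock s
       <= bitlen (memory s a) + K * (clock s + c))%N by nia.
  have le1 n m : (n <= m)%N -> (n <= K * m)%N by nia.
  case: i oracle_small => [x c|o x y z|x y|x y|x|x||x] oracle_small //=;
    apply: write_small => //; try exact: ltn_addr;
    try (by apply: oracle_small; rewrite mem_rcons inE eqxx); apply: le1.
  + by [].
  + exact: bitlen_arith.
  + exact: leq_addl.
  + exact: leq_addl.
  + by case: (guesses s 0%N).
- move=> p1 p2 s1 s2 s3 run1 IH1 run2 IH2 small a.
  have {IH1} := IH1 (fun v vq => small v (exec_queries run2 vq)) a.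
  have {IH2} := IH2 small a; lia.
- move=> x p1 p2 s1 s2 _ _ IH small a; have /= := IH small a; lia.
- move=> x p1 p2 s1 s2 _ _ IH small a; have /= := IH small a; lia.
- move=> x p s _ _ a /=; lia.
move=> x p s1 s2 s3 _ run1 IH1 run2 IH2 small a.
have /= {IH1} := IH1 (fun v vq => small v (exec_queries run2 vq)) a.
have {IH2} := IH2 small a; lia.
Qed.

(** * Two memories and a register file in one memory *)

(** An abstract machine between programs and memory layout: simulations are verified on [config],
    where the two memories are plain functions, and the address arithmetic of each macro is treated
    once, in [macro_exec]. *)
Inductive macro :=
| MConst of nat & int
| MArith of arith & nat & nat & nat
| MLoad of bool & nat & nat
| MStore of bool & nat & nat
| MGuess of nat
| MPush of nat
| MErase
| MAsk of nat
| MNext.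

(* cmem true is the memory of the reduction and cmem false that of the inner
   algorithm, blanked by MNext. *)
Record config := Config {
  cmem : bool -> int -> int;
  regs : nat -> int;
  stamp : nat;
  ctape : word;
  cguesses : nat -> bool;
  cqueries : seq word
}.

Definition set_reg (d : nat) v (x : config) : config :=
  Config (cmem x) (fun j => if j == d then v else regs x j) (stamp x)
    (ctape x) (cguesses x) (cqueries x).

Definition mstep (O : word -> int) (i : macro) (x : config) : config :=
  let: Config m r st tp g q := x in
  match i with
  | MConst d c => set_reg d c x
  | MArith o d i j => set_reg d (arith_eval o (r i) (r j)) x
  | MLoad v d i => set_reg d (m v (r i)) x
  | MStore v d i =>
      Config (fun u => if u == v then write (m v) (r d) (r i) else m u)
        r st tp g q
  | MGuess d => set_reg d (g 0%N)%:Z (Config m r st tp (fun i => g i.+1) q)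
  | MPush i => Config m r st (rcons tp (r i)) g q
  | MErase => Config m r st [::] g q
  | MAsk d => set_reg d (O tp) (Config m r st [::] g (rcons q tp))
  | MNext => Config (fun u => if u then m u else fun=> 0) r st.+1 tp g q
  end.

(** Addresses and contents are charged; the arithmetic on addresses is hidden in the constant factor
    of [macro_exec]. *)
Definition mcost (i : macro) (x : config) : nat :=
  let r := regs x in
  match i with
  | MConst d c => bitlen c
  | MArith o d i j => bitlen (r i) + bitlen (r j)
  | MLoad v d i => bitlen (r i) + bitlen (cmem x v (r i)) + bitlen (stamp x)
  | MStore v d i => bitlen (r d) + bitlen (r i) + bitlen (stamp x)
  | MGuess _ => 1
  | MPush i => bitlen (r i)
  | MErase => 1
  | MAsk _ => (size (ctape x)).+1
  | MNext => bitlen (stamp x)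
  end%N.

Fixpoint mrun O (l : seq macro) (x : config) : config :=
  if l is i :: l' then mrun O l' (mstep O i x) else x.

(** The 1 of the empty list pays for the last instruction of [block]. *)
Fixpoint total_mcost O (l : seq macro) (x : config) : nat :=
  if l is i :: l' then (mcost i x + total_mcost O l' (mstep O i x))%N else 1%N.

(* The reduction keeps its nonnegative addresses, so that its input need not be
   moved, and has its negative ones multiplied by 8.  The other residues modulo
   8 of the negative addresses separate stamps (1), contents (2), registers (3),
   a constant 0 (4) and scratch cells (5). *)
Definition reg (j : nat) : int := - (8 * j + 3)%:Z.
Definition zero_cell : int := Negz 3.
Definition stamp_cell : int := Negz 4.
Definition tmp1 : int := Negz 12.
Definition tmp2 : int := Negz 20.
Definition tmp3 : int := Negz 28.

(* The sign of a is recovered as a %/ (a^2 + 1), which is 0 or -1. *)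
Definition cellR (a : int) : int := a * ((a %/ (a * a + 1))%Z * -7 + 1).

(* a |-> 2 a^2 + a is an injection of the integers into the naturals. *)
Definition offsetA (a : int) : int := a * a * 16 + 8 * a.
Definition stampA (a : int) : int := -1 - offsetA a.
Definition cellA (a : int) : int := -2 - offsetA a.

Fixpoint line (i : instr) (l : seq instr) : prog :=
  if l is j :: l' then Then (Instr i) (line j l') else Instr i.

Definition lineR (src : int) (last : seq instr) : prog :=
  line (Arith Mul tmp1 src src)
    [:: Const tmp2 1, Arith Add tmp1 tmp1 tmp2, Arith Div tmp1 src tmp1,
     Const tmp2 (-7), Arith Mul tmp1 tmp1 tmp2, Const tmp2 1,
     Arith Add tmp1 tmp1 tmp2, Arith Mul tmp1 src tmp1 & last].

Definition lineA (src : int) (last : seq instr) : prog :=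
  line (Arith Mul tmp1 src src)
    [:: Const tmp2 16, Arith Mul tmp1 tmp1 tmp2, Const tmp2 8,
     Arith Mul tmp2 tmp2 src, Arith Add tmp1 tmp1 tmp2 & last].

Definition macro_code (i : macro) : prog :=
  match i with
  | MConst d c => Instr (Const (reg d) c)
  | MArith o d i j => Instr (Arith o (reg d) (reg i) (reg j))
  | MLoad true d i => lineR (reg i) [:: Fetch (reg d) tmp1]
  (* A cell with an outdated stamp is not read, as its content may be long:
     the address is then redirected to zero_cell. *)
  | MLoad false d i => lineA (reg i)
     [:: Const tmp2 (-1); Arith Defs.Sub tmp2 tmp2 tmp1; Fetch tmp2 tmp2;
      Arith Div tmp2 tmp2 stamp_cell; Const tmp3 2; Arith Defs.Sub tmp1 tmp3 tmp1;
      Arith Mul tmp1 tmp2 tmp1; Const tmp3 (-4); Arith Add tmp1 tmp1 tmp3;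
      Fetch (reg d) tmp1]
  | MStore true d i => lineR (reg d) [:: Store tmp1 (reg i)]
  | MStore false d i => lineA (reg d)
     [:: Const tmp2 (-1); Arith Defs.Sub tmp3 tmp2 tmp1; Store tmp3 stamp_cell;
      Const tmp2 (-2); Arith Defs.Sub tmp3 tmp2 tmp1; Store tmp3 (reg i)]
  | MGuess d => Instr (Guess (reg d))
  | MPush i => Instr (Push (reg i))
  | MErase => Instr Erase
  | MAsk d => Instr (Ask (reg d))
  | MNext => line (Const tmp1 1) [:: Arith Add stamp_cell stamp_cell tmp1]
  end.

(** There is no empty program; a write to a scratch cell replaces it. *)
Fixpoint block (l : seq macro) : prog :=
  if l is i :: l' then Then (macro_code i) (block l') else Instr (Const tmp1 0).

(** Untouched cells carry stamp 0, which has to count as outdated; so the current stamp is positive.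
    Since no stamp exceeds it, the quotient of a stamp by the current one is 1 if the cell is valid
    and 0 otherwise. *)
Record represents (s : state) (x : config) : Prop := {
  represents_R : forall a, memory s (cellR a) = cmem x true a;
  represents_A : forall a, exists2 st : nat,
    memory s (stampA a) = st /\ (st <= stamp x)%N
    & cmem x false a = if st == stamp x then memory s (cellA a) else 0;
  represents_reg : forall j, memory s (reg j) = regs x j;
  represents_stamp : memory s stamp_cell = stamp x;
  represents_zero : memory s zero_cell = 0;
  represents_pos : (0 < stamp x)%N;
  represents_tape : tape s = ctape x;
  represents_guesses : guesses s = cguesses x;
  represents_queries : queries s = cqueries x
}.

(** As a^2 + 1 > |a|, the quotient is 0 or -1 according to the sign of a, and the factor is 1 or 7 +
    1 = 8. *)
Lemma cellR_cases a : (0 <= a /\ cellR a = a) \/ (a < 0 /\ cellR a = 8 * a).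
Proof.
rewrite /cellR; case: (lerP 0 a) => [a_ge0|a_lt0]; [left|right]; split => //.
  by rewrite divz_small ?mul0r ?add0r ?mulr1 //; apply/andP; split; nia.
suff -> : (a %/ (a * a + 1))%Z = -1 by lia.
have d_gt0 : 0 < a * a + 1 by nia.
have := divz_eq a (a * a + 1); have := ltz_pmod a d_gt0.
have := @modz_ge0 a (a * a + 1) (lt0r_neq0 d_gt0).
move: (a %/ _)%Z (a %% _)%Z => q r; nia.
Qed.

(** Divisibility by 8 pins the residues of [stampA] and [cellA], which turns all disjointness claims
    into linear arithmetic. *)
Lemma offsetA_ge0 a : exists k : nat, offsetA a = 8 * k%:Z.
Proof.
exists (absz (a * a * 2 + a)); rewrite /offsetA.
have : 0 <= a * a * 2 + a by nia.
by move=> ge0; rewrite gez0_abs //; lia.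
Qed.

Lemma cellR_inj : injective cellR.
Proof.
by move=> a b; have := cellR_cases a; have := cellR_cases b; lia.
Qed.

Lemma offsetA_inj : injective offsetA.
Proof.
rewrite /offsetA => a b eq_ab.
(* The second factor is odd, hence nonzero. *)
have : (a - b) * (2 * (a + b) + 1) = 0 by lia.
by move/eqP; rewrite mulf_eq0 => /orP[] /eqP; lia.
Qed.

Lemma stampA_inj : injective stampA.
Proof. by move=> a b eq_ab; apply: offsetA_inj; rewrite /stampA in eq_ab; lia. Qed.

Lemma cellA_inj : injective cellA.
Proof. by move=> a b eq_ab; apply: offsetA_inj; rewrite /cellA in eq_ab; lia. Qed.

Lemma represents_set_reg s s' x d v :
    represents s x -> memory s' (reg d) = v ->
    (forall b, b <> tmp1 -> b <> tmp2 -> b <> tmp3 -> b <> reg d ->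
       memory s' b = memory s b) ->
    tape s' = tape s -> guesses s' = guesses s -> queries s' = queries s ->
  represents s' (set_reg d v x).
Proof.
move=> [eqR eqA eq_reg eq_st eq0 st_gt0 eq_tp eq_g eq_q] eq_d keep tp g q.
split=> //=; rewrite ?tp ?g ?q //.
- move=> a; rewrite keep //; have := cellR_cases a;
    rewrite /tmp1 /tmp2 /tmp3 /reg; lia.
- move=> a; have [st [st_a st_le] ->] := eqA a; have [k off_a] := offsetA_ge0 a.
  exists st; first by rewrite keep // /stampA off_a /tmp1 /tmp2 /tmp3 /reg; lia.
  by rewrite keep // /cellA off_a /tmp1 /tmp2 /tmp3 /reg; lia.
- move=> j; case: eqP => [-> //|ne_j].
  by rewrite keep // /tmp1 /tmp2 /tmp3 /reg; lia.
- by rewrite keep // /tmp1 /tmp2 /tmp3 /reg /stamp_cell; lia.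
by rewrite keep // /tmp1 /tmp2 /tmp3 /reg /zero_cell; lia.
Qed.

(** * Execution of macros by straight-line code *)

Ltac read_writes := repeat first
  [ rewrite write_same
  | rewrite write_other; [|rewrite /tmp1 /tmp2 /tmp3 /reg; lia] ].

Lemma bitlen_literals :
  (bitlen 1 = 1%N) * (bitlen 2 = 2%N) * (bitlen 8 = 4%N) * (bitlen 16 = 5%N) *
  (bitlen (-1) = 1%N) * (bitlen (-2) = 2%N) * (bitlen (-4) = 3%N) *
  (bitlen (-7) = 3%N) * (bitlen 0 = 1%N).
Proof. by []. Qed.

#[local] Arguments arith_eval : simpl never.

Ltac bound_bitlens := repeat match goal with
  | |- context [bitlen (arith_eval ?o ?x ?y)] =>
      have := bitlen_arith o x y;
      let b := fresh "b" in
      move: (bitlen (arith_eval o x y)) => b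
  end.

Section Steps.
Variables (O : word -> int) (m : int -> int) (tp : word) (g : nat -> bool).
Variables (k : nat) (q : seq word).
Local Notation S m k := (State m tp g k q).

Lemma exec_const x c : exec O (Instr (Const x c)) (S m k) (S (write m x c) (k + bitlen c)%N).
Proof. exact: ExecInstr. Qed.

Lemma exec_arith o x y z b c : m y = b -> m z = c ->
  exec O (Instr (Arith o x y z)) (S m k)
    (S (write m x (arith_eval o b c)) (k + (bitlen b + bitlen c))%N).
Proof. by move=> <- <-; apply: ExecInstr. Qed.

Lemma exec_fetch x y b c : m y = b -> m b = c ->
  exec O (Instr (Fetch x y)) (S m k)
    (S (write m x c) (k + (bitlen b + bitlen c))%N).
Proof. by move=> <- <-; apply: ExecInstr. Qed.

Lemma exec_store x y b c : m x = b -> m y = c ->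
  exec O (Instr (Store x y)) (S m k)
    (S (write m b c) (k + (bitlen b + bitlen c))%N).
Proof. by move=> <- <-; apply: ExecInstr. Qed.

End Steps.

Ltac read_memory := by read_writes; reflexivity.
Ltac step := lazymatch goal with
  | |- exec _ (Then _ _) _ _ => eapply ExecThen; [step|]
  | |- exec _ (Instr (Const _ _)) _ _ => exact: exec_const
  | |- exec _ (Instr (Arith _ _ _ _)) _ _ => apply: exec_arith; read_memory
  end.

(** Stated with a continuation because [line] nests to the right, so that the address computation is
    not a subprogram. *)
Lemma lineR_exec O j m tp g k q : exists m' c,
  [/\ m' tmp1 = cellR (m (reg j)),
      forall b, b <> tmp1 -> b <> tmp2 -> m' b = m b,
      (c <= 80 * bitlen (m (reg j)))%N
    & forall i l s2,
        exec O (line i l) (State m' tp g (k + c) q) s2 ->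
        exec O (lineR (reg j) (i :: l)) (State m tp g k q) s2].
Proof.
(* The run is treated first, as it determines the final memory and the cost. *)
do 2 eexists; split; last first.
- move=> i l s2 run; rewrite /lineR /=; do 9 step; rewrite -!addnA.
  exact: run.
- have := bitlen_gt0 (m (reg j)).
  bound_bitlens; rewrite !bitlen_literals; lia.
- by move=> b ne1 ne2; rewrite !(write_other _ _ ne1, write_other _ _ ne2).
by read_writes; rewrite /cellR.
Qed.

Lemma lineA_exec O j m tp g k q : exists m' c,
  [/\ m' tmp1 = offsetA (m (reg j)),
      forall b, b <> tmp1 -> b <> tmp2 -> m' b = m b,
      (c <= 80 * bitlen (m (reg j)))%N
    & forall i l s2,
        exec O (line i l) (State m' tp g (k + c) q) s2 ->
        exec O (lineA (reg j) (i :: l)) (State m tp g k q) s2].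
Proof.
do 2 eexists; split; last first.
- move=> i l s2 run; rewrite /lineA /=; do 6 step; rewrite -!addnA.
  exact: run.
- have := bitlen_gt0 (m (reg j)).
  bound_bitlens; rewrite !bitlen_literals; lia.
- by move=> b ne1 ne2; rewrite !(write_other _ _ ne1, write_other _ _ ne2).
by read_writes.
Qed.

Lemma cellR_not_tmp a :
  [/\ cellR a <> tmp1, cellR a <> tmp2, cellR a <> tmp3,
      cellR a <> stamp_cell & cellR a <> zero_cell].
Proof.
by have := cellR_cases a; split;
  rewrite /tmp1 /tmp2 /tmp3 /stamp_cell /zero_cell; lia.
Qed.

Lemma bitlen_cellR a : (bitlen (cellR a) <= 4 + bitlen a)%N.
Proof.
apply: leq_trans (bitlen_arith Mul 8 a); apply: leq_bitlen; rewrite /arith_eval.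
by have := cellR_cases a; lia.
Qed.

Lemma bitlen_offsetA a : (bitlen (offsetA a) <= 9 + 3 * bitlen a)%N.
Proof.
have -> : offsetA a = arith_eval Add
  (arith_eval Mul (arith_eval Mul a a) 16) (arith_eval Mul 8 a) by [].
bound_bitlens; rewrite !bitlen_literals; lia.
Qed.

Lemma bitlen_stampA a : (bitlen (stampA a) <= 10 + 3 * bitlen a)%N.
Proof.
apply: leq_trans (bitlen_arith Defs.Sub (-1) (offsetA a)) _.
by have := bitlen_offsetA a; rewrite bitlen_literals; lia.
Qed.

Lemma bitlen_cellA a : (bitlen (cellA a) <= 11 + 3 * bitlen a)%N.
Proof.
apply: leq_trans (bitlen_arith Defs.Sub (-2) (offsetA a)) _.
by have := bitlen_offsetA a; rewrite bitlen_literals; lia.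
Qed.

Lemma cellR_not_A a b :
  [/\ cellR a <> stampA b, cellR a <> cellA b & forall j, cellR a <> reg j].
Proof.
have := cellR_cases a; have [k off_b] := offsetA_ge0 b.
by rewrite /stampA /cellA off_b; split; rewrite /reg; lia.
Qed.

Lemma stampA_not_tmp a :
  [/\ stampA a <> tmp1, stampA a <> tmp2, stampA a <> tmp3,
      stampA a <> stamp_cell & stampA a <> zero_cell].
Proof.
have [k off_a] := offsetA_ge0 a.
by split; rewrite /stampA off_a /tmp1 /tmp2 /tmp3 /stamp_cell /zero_cell; lia.
Qed.

Lemma cellA_not_tmp a :
  [/\ cellA a <> tmp1, cellA a <> tmp2, cellA a <> tmp3,
      cellA a <> stamp_cell & cellA a <> zero_cell].
Proof.
have [k off_a] := offsetA_ge0 a.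
by split; rewrite /cellA off_a /tmp1 /tmp2 /tmp3 /stamp_cell /zero_cell; lia.
Qed.

Lemma cellA_not_stampA a b :
  cellA a <> stampA b /\ forall j, cellA a <> reg j /\ stampA a <> reg j.
Proof.
have [k off_a] := offsetA_ge0 a; have [l off_b] := offsetA_ge0 b.
by rewrite /cellA /stampA off_a off_b; split=> [|j]; rewrite /reg; lia.
Qed.

Lemma loadR_exec O d i s x : represents s x -> exists s',
  [/\ exec O (macro_code (MLoad true d i)) s s',
      represents s' (mstep O (MLoad true d i) x)
    & (clock s' <= clock s + 200 * mcost (MLoad true d i) x)%N].
Proof.
case: s x => m tp g k q [M r st tp' g' q'] rep.
have [eqR _ eq_reg _ _ _ _ _ _] := rep; rewrite /= in eqR eq_reg.
have [m' [c [m1 keep c_le go]]] := lineR_exec O i m tp g k q.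
have [ne1 ne2 _ _ _] := cellR_not_tmp (r i).
eexists; split.
- apply: go; apply: exec_fetch; first exact: m1.
  by rewrite eq_reg keep // eqR.
- apply: (represents_set_reg rep) => //= [|b *]; first by rewrite write_same.
  by rewrite write_other // keep.
rewrite /= eq_reg in c_le *.
have := bitlen_cellR (r i); have := bitlen_gt0 (r i); lia.
Qed.

Lemma storeR_exec O d i s x : represents s x -> exists s',
  [/\ exec O (macro_code (MStore true d i)) s s',
      represents s' (mstep O (MStore true d i) x)
    & (clock s' <= clock s + 200 * mcost (MStore true d i) x)%N].
Proof.
case: s x => m tp g k q [M r st tp' g' q'] [] /=
  eqR eqA eq_reg eq_st eq0 st_gt0 eq_tp eq_g eq_q.
have [m' [c [m1 keep c_le go]]] := lineR_exec O d m tp g k q.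
eexists; split.
- apply: go; apply: exec_store; first by rewrite m1 eq_reg.
  by rewrite keep ?eq_reg // /tmp1 /tmp2 /reg; lia.
- split=> //=.
  + move=> a; have [ne1 ne2 _ _ _] := cellR_not_tmp a; case: (a =P r d) => [->|ne].
      by rewrite !write_same.
    by rewrite !write_other ?keep ?eqR // => /cellR_inj.
  + move=> a; have [st' [st_a st_le] ->] := eqA a; exists st'.
      rewrite write_other; last by have [? _ _] := cellR_not_A (r d) a; auto.
      by have [? ? _ _ _] := stampA_not_tmp a; rewrite keep.
    rewrite write_other; last by have [_ ? _] := cellR_not_A (r d) a; auto.
    by have [? ? _ _ _] := cellA_not_tmp a; rewrite keep.
  + move=> j; have [_ _ ne] := cellR_not_A (r d) 0.
    rewrite write_other; last by have := ne j; auto.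
    by rewrite keep // /tmp1 /tmp2 /reg; lia.
  + have [_ _ _ ne _] := cellR_not_tmp (r d).
    by rewrite write_other ?keep //; auto.
  have [_ _ _ _ ne] := cellR_not_tmp (r d).
  by rewrite write_other ?keep //; auto.
rewrite /= !eq_reg in c_le *.
have := bitlen_cellR (r d); have := bitlen_gt0 (r d); lia.
Qed.

Lemma loadA_exec O d i s x : represents s x -> exists s',
  [/\ exec O (macro_code (MLoad false d i)) s s',
      represents s' (mstep O (MLoad false d i) x)
    & (clock s' <= clock s + 200 * mcost (MLoad false d i) x)%N].
Proof.
case: s x => m tp g k q [M r st tp' g' q'] rep.
have [_ eqA eq_reg eq_st eq0 st_gt0 _ _ _] := rep; rewrite /= in eqA eq_reg eq_st eq0 st_gt0.
have [m' [c [m1 keep c_le go]]] := lineA_exec O i m tp g k q.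
rewrite eq_reg in m1 c_le.
have [st' [st_a st_le] eqA_a] := eqA (r i).
have [ns1 ns2 ns3 _ _] := stampA_not_tmp (r i).
have [nc1 nc2 nc3 _ _] := cellA_not_tmp (r i).
have keep_st : m' stamp_cell = st by rewrite keep.
eexists; split.
- apply: go => /=.
  step; eapply ExecThen.
    by apply: exec_arith; [read_memory | rewrite write_other; [exact: m1 | by []]].
  eapply ExecThen.
    apply: (@exec_fetch _ _ _ _ _ _ _ _ (stampA (r i)) st'%:Z); first read_memory.
    by rewrite !write_other // keep.
  eapply ExecThen.
    by apply: exec_arith; [read_memory | do ?[rewrite write_other; last by []]; exact: keep_st].
  step; eapply ExecThen.
    by apply: exec_arith; [read_memory | do ?[rewrite write_other; last by []]; exact: m1].
  do 3 step.
  (* With b the quotient of the stamps, the address in [tmp1] is b * (2 - offset) - 4: the cell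
     itself for b = 1, and [zero_cell], which is -4, for b = 0. *)
  apply: (@exec_fetch _ _ _ _ _ _ _ _
            (if st' == st then cellA (r i) else zero_cell) (M false (r i))).
    read_writes; rewrite /arith_eval; case: eqP => [->|ne].
      by rewrite divzz -lt0n st_gt0 /cellA; lia.
    by rewrite divz_small ?mul0r //; lia.
  rewrite eqA_a; case: eqP => _; first by rewrite !write_other // keep.
  by rewrite !write_other // keep.
- apply: (represents_set_reg rep) => //= [|b *]; first by rewrite write_same.
  by rewrite !write_other // keep.
rewrite /=.
have st'_le := bitlen_nat st_le.
have redirected_le : (bitlen (if st' == st then cellA (r i) else zero_cell)
                      <= 11 + 3 * bitlen (r i))%N.
  by case: eqP => _; [exact: bitlen_cellA | apply: leq_trans (leq_addr _ _)].
move: (bitlen_stampA (r i)) (bitlen_offsetA (r i)) (bitlen_gt0 (r i)).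
move: (bitlen_gt0 (M false (r i))) (bitlen_gt0 st).
bound_bitlens; rewrite !bitlen_literals; lia.
Qed.

Lemma storeA_exec O d i s x : represents s x -> exists s',
  [/\ exec O (macro_code (MStore false d i)) s s',
      represents s' (mstep O (MStore false d i) x)
    & (clock s' <= clock s + 200 * mcost (MStore false d i) x)%N].
Proof.
case: s x => m tp g k q [M r st tp' g' q'] [] /=
  eqR eqA eq_reg eq_st eq0 st_gt0 eq_tp eq_g eq_q.
have [m' [c [m1 keep c_le go]]] := lineA_exec O d m tp g k q.
rewrite eq_reg in m1 c_le.
have [ns1 ns2 ns3 ns4 ns5] := stampA_not_tmp (r d).
have [nc1 nc2 nc3 nc4 nc5] := cellA_not_tmp (r d).
have [_ nreg] := cellA_not_stampA (r d) 0.
have keep_st : m' stamp_cell = st by rewrite keep.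
have keep_reg j : m' (reg j) = r j.
  by rewrite keep // /tmp1 /tmp2 /reg; lia.
eexists; split.
- apply: go => /=.
  step; eapply ExecThen.
    by apply: exec_arith; [read_memory | rewrite write_other; [exact: m1 | by []]].
  eapply ExecThen.
    apply: (@exec_store _ _ _ _ _ _ _ _ (stampA (r d)) st); first read_memory.
    by rewrite !write_other.
  step; eapply ExecThen.
    apply: exec_arith; first read_memory.
    by do ?[rewrite write_other; last by auto]; exact: m1.
  apply: (@exec_store _ _ _ _ _ _ _ _ (cellA (r d)) (r i)); first read_memory.
  rewrite !write_other //; try by rewrite /tmp1 /tmp2 /tmp3 /reg; lia.
  by have [_] := nreg i; auto.
- split=> //=.
  + move=> a; have [na1 na2 na3 _ _] := cellR_not_tmp a.
    have [nas nac _] := cellR_not_A a (r d).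
    by rewrite !write_other ?keep.
  + move=> a; have [na1 na2 na3 _ _] := stampA_not_tmp a.
    have [nb1 nb2 nb3 _ _] := cellA_not_tmp a.
    have [nca _] := cellA_not_stampA (r d) a.
    have [ncb _] := cellA_not_stampA a (r d).
    case: (a =P r d) => [->|ne].
      exists st; last by rewrite eqxx !write_same.
      split => //; rewrite 3?write_other ?write_same //.
      by have [ne _] := cellA_not_stampA (r d) (r d); auto.
    have ne_s : stampA a <> stampA (r d) by move/stampA_inj.
    have ne_c : cellA a <> cellA (r d) by move/cellA_inj.
    have [st' [st_a st_le] eqM] := eqA a; exists st'.
      by rewrite !write_other ?keep //; auto.
    rewrite (write_other _ _ ne) eqM.
    by case: ifP => // _; rewrite !write_other ?keep.
  + move=> j; have [ncj nsj] := nreg j.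
    rewrite !write_other ?keep_reg //; auto;
      by rewrite /tmp1 /tmp2 /tmp3 /reg; lia.
  + by rewrite !write_other //; auto.
  by rewrite !write_other ?keep //; auto.
rewrite /=.
move: (bitlen_stampA (r d)) (bitlen_offsetA (r d)) (bitlen_cellA (r d)).
move: (bitlen_gt0 (r d)) (bitlen_gt0 (r i)) (bitlen_gt0 st).
bound_bitlens; rewrite !bitlen_literals; lia.
Qed.

Lemma macro_exec O i s x : represents s x -> exists s',
  [/\ exec O (macro_code i) s s', represents s' (mstep O i x)
    & (clock s' <= clock s + 200 * mcost i x)%N].
Proof.
move=> rep; case: i => [d c|o d i j|[] d i|[] d i|d|i||d|];
  try by [apply: loadR_exec | apply: loadA_exec
         |apply: storeR_exec | apply: storeA_exec];
  case: s x rep => m tp g k q [M r st tp' g' q'] rep;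
  have [eqR eqA eq_reg eq_st eq0 st_gt0 eq_tp eq_g eq_q] := rep;
  rewrite /= in eqR eqA eq_reg eq_st eq0 st_gt0 eq_tp eq_g eq_q.
- eexists; split; first exact: exec_const; last by rewrite /=; lia.
  by apply: (represents_set_reg rep) => //= *; rewrite ?write_same ?write_other.
- eexists; split; first (by apply: exec_arith; exact: eq_reg);
    last by rewrite /=; lia.
  by apply: (represents_set_reg rep) => //= *; rewrite ?write_same ?write_other.
- eexists; split; first exact: ExecInstr; last by rewrite /=; lia.
  set s := State m tp (fun i => g i.+1) k q.
  have rep' : represents s (Config M r st tp' (fun i => g' i.+1) q').
    by split=> //=; rewrite eq_g.
  apply: (represents_set_reg rep') => //= [|b *]; last by rewrite write_other.
  by rewrite write_same eq_g.
- eexists; split; first exact: ExecInstr; last by rewrite /= eq_reg; lia.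
  by split=> //=; rewrite eq_tp eq_reg.
- by eexists; split; first exact: ExecInstr; last by rewrite /=; lia.
- eexists; split; first exact: ExecInstr; last by rewrite /= eq_tp; lia.
  set s := State m [::] g k (rcons q tp).
  have rep' : represents s (Config M r st [::] g' (rcons q' tp')).
    by split=> //=; rewrite eq_q eq_tp.
  apply: (represents_set_reg rep') => //= [|b *]; last by rewrite write_other.
  by rewrite write_same eq_tp.
eexists; split.
- by rewrite /=; step; apply: exec_arith; [rewrite write_other // | read_memory].
- split=> //=.
  + move=> a; have [? _ _ ? _] := cellR_not_tmp a.
    by rewrite !write_other.
  + move=> a; have [? ? ? ? _] := stampA_not_tmp a; have [st' [st_a st_le] _] := eqA a.
    exists st'; first by rewrite !write_other // (leq_trans st_le).
    (* No stamp exceeds the old value, so raising the current stamp outdates every cell at once. *)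
    by case: eqP st_le => // ->; rewrite ltnn.
  + by move=> j; rewrite !write_other // /tmp1 /stamp_cell /reg; lia.
  + by rewrite write_same eq_st /arith_eval; lia.
rewrite /= eq_st; have := bitlen_gt0 st; rewrite bitlen_literals; lia.
Qed.

Lemma block_exec O l s x : represents s x -> exists s',
  [/\ exec O (block l) s s', represents s' (mrun O l x)
    & (clock s' <= clock s + 200 * total_mcost O l x)%N].
Proof.
elim: l s x => [|i l IH] s x rep /=.
  eexists; split; first exact: ExecInstr; last by rewrite /= bitlen_literals; lia.
  case: rep => eqR eqA eq_reg eq_st eq0 st_gt0 eq_tp eq_g eq_q; split=> //=.
  + by move=> a; have [? _ _ _ _] := cellR_not_tmp a; rewrite write_other.
  + move=> a; have [? _ _ _ _] := stampA_not_tmp a.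
    have [? _ _ _ _] := cellA_not_tmp a; rewrite !write_other //.
  by move=> j; rewrite write_other // /tmp1 /reg; lia.
have [s1 [run1 rep1 c1]] := macro_exec O i rep.
have [s2 [run2 rep2 c2]] := IH _ _ rep1.
by exists s2; split=> //; [exact: ExecThen run1 run2 | lia].
Qed.

(** * Simulation of a program on the second memory *)

(** A fixed address is free in the simulated program, but the simulation loads it by [MConst] and
    computes with it. The weight bounds the length of all these addresses by a constant of the
    program. *)
Fixpoint weight (p : prog) : nat :=
  match p with
  | Instr (Const x _) => bitlen x
  | Instr (Arith _ x y z) => bitlen x + bitlen y + bitlen z
  | Instr (Fetch x y) | Instr (Store x y) => bitlen x + bitlen y
  | Instr (Guess x) | Instr (Push x) | Instr (Ask x) => bitlen x
  | Instr Erase => 1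
  | Then p1 p2 => weight p1 + weight p2
  | IfPos x p1 p2 => bitlen x + weight p1 + weight p2
  | WhilePos x p1 => bitlen x + weight p1
  end%N.

(* Register 0 holds the length of the simulated tape of the reduction and
   register 1 tells whether the simulation is still alive. *)
Definition read (v : bool) (d : nat) (x : int) : seq macro :=
  [:: MConst 2 x; MLoad v d 2].

Definition save (v : bool) (x : int) (i : nat) : seq macro :=
  [:: MConst 2 x; MStore v 2 i].

Definition memory_macros (v : bool) (i : instr) : seq macro :=
  match i with
  | Const x c => MConst 3 c :: save v x 3
  | Arith o x y z =>
      read v 3 y ++ read v 4 z ++ MArith o 3 3 4 :: save v x 3
  | Fetch x y => read v 3 y ++ MLoad v 3 3 :: save v x 3
  | Store x y => read v 3 x ++ read v 4 y ++ [:: MStore v 3 4]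
  | _ => [::]
  end.

Definition is_memory (i : instr) : bool :=
  match i with Const _ _ | Arith _ _ _ _ | Fetch _ _ | Store _ _ => true
  | _ => false end.

Definition instr_macros (i : instr) : seq macro :=
  match i with
  | Guess x => MGuess 3 :: save false x 3
  | Push x => read false 3 x ++ [:: MPush 3]
  | Erase => [:: MErase]
  | Ask x => MAsk 3 :: save false x 3
  | _ => memory_macros false i
  end.

Fixpoint compile (p : prog) : prog :=
  match p with
  | Instr i => block (instr_macros i)
  | Then p1 p2 => Then (compile p1) (compile p2)
  | IfPos x p1 p2 =>
      Then (block (read false 3 x)) (IfPos (reg 3) (compile p1) (compile p2))
  | WhilePos x p1 =>
      Then (block (read false 3 x))
        (WhilePos (reg 3) (Then (compile p1) (block (read false 3 x))))
  end.

Record frame (x x' : config) : Prop := {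
  frame_mem : cmem x' true = cmem x true;
  frame_regs : forall j, (j < 2)%N -> regs x' j = regs x j;
  frame_stamp : stamp x' = stamp x
}.

Lemma frame_trans x y z : frame x y -> frame y z -> frame x z.
Proof.
move=> [m1 r1 s1] [m2 r2 s2]; split; rewrite ?m2 ?s2 // => j lt_j.
by rewrite r2 ?r1.
Qed.

Lemma eq_write (m m' : int -> int) a v : m =1 m' -> write m a v =1 write m' a v.
Proof. by move=> eq_m b; rewrite /write eq_m. Qed.

Lemma memory_macros_correct O v i s x :
    is_memory i -> cmem x v =1 memory s ->
  let x' := mrun O (memory_macros v i) x in
  [/\ cmem x' v =1 memory (instr_effect O i s), cmem x' (~~ v) = cmem x (~~ v),
      [/\ forall j, (j < 2)%N -> regs x' j = regs x j, stamp x' = stamp x,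
          ctape x' = ctape x, cguesses x' = cguesses x
        & cqueries x' = cqueries x]
    & (total_mcost O (memory_macros v i) x
       <= 10 * (weight (Instr i) + bitlen (stamp x) + instr_cost i s))%N].
Proof.
case: x => M r st tp g q; rewrite /= => mem_i eq_M.
case: i mem_i => [y c|o y z z'|y z|y z|y|y||y] //= _; rewrite ?eqxx /=;
  (split; [|by case: (v)|split => //; by case=> [|[|j]]|]).
- exact: eq_write.
- rewrite /mcost /=; have := bitlen_gt0 y; lia.
- by rewrite !eq_M; exact: eq_write.
- rewrite /mcost /= !eq_M.
  have := bitlen_gt0 y; have := bitlen_arith o (memory s z) (memory s z'); lia.
- by rewrite !eq_M; exact: eq_write.
- rewrite /mcost /= !eq_M; have := bitlen_gt0 y; lia.
- by rewrite !eq_M; exact: eq_write.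
rewrite /mcost /= !eq_M; have := bitlen_gt0 y; lia.
Qed.

Section Inner.
Variables (O : word -> int) (K L W : nat) (q0 : seq word).
Hypothesis K_gt0 : (0 < K)%N.

(** [q0] holds the queries of earlier inner runs: the machine never forgets its queries, while each
    simulated run starts with none. *)
Record inner (x : config) (s : state) : Prop := {
  inner_mem : cmem x false =1 memory s;
  inner_tape : ctape x = tape s;
  inner_guesses : cguesses x = guesses s;
  inner_queries : cqueries x = q0 ++ queries s;
  inner_stamp : (bitlen (stamp x) <= L)%N
}.

Lemma instr_macros_correct i s x :
    inner x s -> (weight (Instr i) <= W)%N ->
    (forall v, v \in queries (instr_effect O i s) ->
       (bitlen (O v) <= K * (size v).+1)%N) ->
  let x' := mrun O (instr_macros i) x in
  [/\ inner x' (tick (instr_cost i s) (instr_effect O i s)), frame x x'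
    & (total_mcost O (instr_macros i) x <= 10 * (W + L + K) * instr_cost i s)%N].
Proof.
move=> [eq_M eq_tp eq_g eq_q st_le] le_W small.
have expand c : (0 < c)%N ->
    (10 * (W + L + c) <= 10 * (W + L + K) * c)%N by nia.
case: (boolP (is_memory i)) => [mem_i|].
  have -> : instr_macros i = memory_macros false i by case: i mem_i {le_W small}.
  have [eq_mem eqR [eq_r eq_st eq_tp' eq_g' eq_q'] cost_le] :=
    memory_macros_correct O mem_i eq_M.
  split.
  - split=> /=; rewrite ?eq_tp' ?eq_g' ?eq_q' ?eq_st //.
    + by rewrite eq_tp; case: i mem_i {le_W small eq_mem eq_r eqR eq_st eq_tp' eq_g' eq_q' cost_le}.
    + by rewrite eq_g; case: i mem_i {le_W small eq_mem eq_r eqR eq_st eq_tp' eq_g' eq_q' cost_le}.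
    by rewrite eq_q; case: i mem_i {le_W small eq_mem eq_r eqR eq_st eq_tp' eq_g' eq_q' cost_le}.
  - by split.
  apply: leq_trans cost_le _; apply: leq_trans (expand _ (instr_cost_gt0 _ _)).
  by lia.
case: x eq_M eq_tp eq_g eq_q st_le => M r st tp g q /= eq_M eq_tp eq_g eq_q st_le.
case: i le_W small => [y c|o y z z'|y z|y z|y|y||y] //= le_W small _.
- split; [|by split=> //=; case=> [|[|j]]|].
    by split=> //=; rewrite ?eq_g //; exact: eq_write.
  rewrite /mcost /=; have -> : bitlen (g 0%N) = 1%N by case: (g 0%N).
  by have := bitlen_gt0 y; lia.
- split; [by split=> //=; rewrite ?eq_tp ?eq_M | by split=> //=; case=> [|[|j]]|].
  by rewrite /mcost /= !eq_M; have := bitlen_gt0 (memory s y); nia.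
- by split; [split | split | rewrite /mcost /=; lia].
split; [|by split=> //=; case=> [|[|j]]|].
  split=> //=; rewrite ?eq_tp ?eq_q -?rcons_cat //.
  exact: eq_write.
rewrite /mcost /= eq_tp.
(* The simulated [Ask] pays for the query only, while the simulation also pays for storing the
   answer: this is where K enters. *)
have := small (tape s); rewrite mem_rcons inE eqxx => /(_ isT).
by have := bitlen_gt0 y; nia.
Qed.

Lemma read_correct d y s x :
    (1 < d)%N -> inner x s -> (bitlen y <= W)%N ->
  let x' := mrun O (read false d y) x in
  [/\ inner x' s, frame x x', regs x' d = memory s y
    & (total_mcost O (read false d y) x
       <= 10 * (W + L + K) * bitlen (memory s y))%N].
Proof.
move=> d_gt1 [eq_M eq_tp eq_g eq_q st_le] le_W.
case: x eq_M eq_tp eq_g eq_q st_le => M r st tp g q /= eq_M eq_tp eq_g eq_q st_le.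
split=> //=; last first.
- by rewrite /mcost /= eq_M; have := bitlen_gt0 (memory s y); nia.
- by rewrite eqxx eq_M.
by split=> //= j lt_j; rewrite !ifF //; apply/eqP; lia.
Qed.

(* The factor in front of the clock of s carries the accumulated cost: the
   increments of the two clocks are compared without subtraction. *)
Lemma compile_correct p s1 s2 : exec O p s1 s2 -> (weight p <= W)%N ->
    (forall v, v \in queries s2 -> (bitlen (O v) <= K * (size v).+1)%N) ->
  forall t1 x1, represents t1 x1 -> inner x1 s1 ->
  exists t2 x2,
    [/\ exec O (compile p) t1 t2, represents t2 x2, inner x2 s2, frame x1 x2
      & (clock t2 + 3000 * (W + L + K) * clock s1
         <= clock t1 + 3000 * (W + L + K) * clock s2)%N].
Proof.
(* In 3000, the factor 200 of [block_exec] times the 10 of the macro costs makes 2000; the rest is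
   room for the tests on register 3. *)
set N := (W + L + K)%N; have N_gt0 : (0 < N)%N by rewrite /N; lia.
elim=> {p s1 s2}.
- move=> i s le_W small t1 x1 rep1 in1.
  have [in2 fr cost] := instr_macros_correct in1 le_W small.
  have [t2 [run2 rep2 c2]] := block_exec O (instr_macros i) rep1.
  exists t2, (mrun O (instr_macros i) x1); split=> //=.
  have -> : clock (instr_effect O i s) = clock s by case: (i).
  by rewrite -/N in cost; nia.
- move=> p1 p2 s1 s2 s3 run1 IH1 run2 IH2 /= le_W small t1 x1 rep1 in1.
  have [|v vq|t2 [x2 [crun1 rep2 in2 fr1 c1]]] := IH1 _ _ t1 x1 rep1 in1.
  + by lia.
  + by apply: small; apply: exec_queries run2 _ _.
  have [||t3 [x3 [crun2 rep3 in3 fr2 c2]]] := IH2 _ _ t2 x2 rep2 in2 => //.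
  + by lia.
  exists t3, x3; split=> //; first exact: ExecThen crun1 crun2.
    exact: frame_trans fr1 fr2.
  by lia.
- move=> y p1 p2 s1 s2 y_gt0 run IH /= le_W small t1 x1 rep1 in1.
  have [|in2 fr1 eq_r cost] := @read_correct 3 y s1 x1 isT in1; first by lia.
  have [t2 [crun1 rep2 c1]] := block_exec O (read false 3 y) rep1.
  have eq3 : memory t2 (reg 3) = memory s1 y by rewrite (represents_reg rep2).
  set t2' := tick (bitlen (memory t2 (reg 3))) t2.
  have rep2' : represents t2' (mrun O (read false 3 y) x1) by case: rep2.
  have in2' : inner (mrun O (read false 3 y) x1)
                (tick (bitlen (memory s1 y)) s1) by case: in2.
  have [||t3 [x3 [crun2 rep3 in3 fr2 c2]]] := IH _ _ t2' _ rep2' in2' => //.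
  + by lia.
  exists t3, x3; split=> //; first apply: ExecThen crun1 _.
  + by apply: ExecIfTrue; rewrite ?eq3 // -eq3.
  + exact: frame_trans fr1 fr2.
  rewrite /t2' /= eq3 in c2; rewrite -/N in cost.
  have := bitlen_gt0 (memory s1 y); nia.
- move=> y p1 p2 s1 s2 y_le0 run IH /= le_W small t1 x1 rep1 in1.
  have [|in2 fr1 eq_r cost] := @read_correct 3 y s1 x1 isT in1; first by lia.
  have [t2 [crun1 rep2 c1]] := block_exec O (read false 3 y) rep1.
  have eq3 : memory t2 (reg 3) = memory s1 y by rewrite (represents_reg rep2).
  set t2' := tick (bitlen (memory t2 (reg 3))) t2.
  have rep2' : represents t2' (mrun O (read false 3 y) x1) by case: rep2.
  have in2' : inner (mrun O (read false 3 y) x1)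
                (tick (bitlen (memory s1 y)) s1) by case: in2.
  have [||t3 [x3 [crun2 rep3 in3 fr2 c2]]] := IH _ _ t2' _ rep2' in2' => //.
  + by lia.
  exists t3, x3; split=> //; first apply: ExecThen crun1 _.
  + by apply: ExecIfFalse; rewrite ?eq3 // -eq3.
  + exact: frame_trans fr1 fr2.
  rewrite /t2' /= eq3 in c2; rewrite -/N in cost.
  have := bitlen_gt0 (memory s1 y); nia.
- move=> y p s y_le0 /= le_W small t1 x1 rep1 in1.
  have [|in2 fr1 eq_r cost] := @read_correct 3 y s x1 isT in1; first by lia.
  have [t2 [crun1 rep2 c1]] := block_exec O (read false 3 y) rep1.
  have eq3 : memory t2 (reg 3) = memory s y by rewrite (represents_reg rep2).
  exists (tick (bitlen (memory t2 (reg 3))) t2), (mrun O (read false 3 y) x1).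
  split=> //.
  + by apply: ExecThen crun1 _; apply: ExecWhileStop; rewrite eq3.
  + by case: rep2.
  + by case: in2.
  rewrite /= eq3; rewrite -/N in cost.
  have := bitlen_gt0 (memory s y); nia.
move=> y p s1 s2 s3 y_gt0 run1 IH1 run2 IH2 /= le_W small t1 x1 rep1 in1.
have [|in2 fr1 eq_r cost] := @read_correct 3 y s1 x1 isT in1; first by lia.
have [t2 [crun1 rep2 c1]] := block_exec O (read false 3 y) rep1.
have eq3 : memory t2 (reg 3) = memory s1 y by rewrite (represents_reg rep2).
set t2' := tick (bitlen (memory t2 (reg 3))) t2.
have rep2' : represents t2' (mrun O (read false 3 y) x1) by case: rep2.
have in2' : inner (mrun O (read false 3 y) x1)
              (tick (bitlen (memory s1 y)) s1) by case: in2.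
have [|v vq|t3 [x3 [crun2 rep3 in3 fr2 c2]]] := IH1 _ _ t2' _ rep2' in2'.
- by lia.
- by apply: small; apply: exec_queries run2 _ _.
have [||t4 [x4 [crun3 rep4 in4 fr3 c3]]] := IH2 _ _ t3 _ rep3 in3 => //.
exists t4, x4; split=> //.
(* The compiled rest of the loop begins with a read of the test cell; this read becomes the end of
   the present turn of the body. *)
- inversion crun3 as [|? ? ? t3' ? crun_read crun_loop| | | |]; subst.
  apply: ExecThen crun1 _; apply: ExecWhileStep crun_loop; first by rewrite eq3.
  exact: ExecThen crun2 crun_read.
- exact: frame_trans fr1 (frame_trans fr2 fr3).
rewrite /t2' /= eq3 in c2; rewrite -/N in cost.
have := bitlen_gt0 (memory s1 y); nia.
Qed.

End Inner.

(** * Composition of a reduction with an algorithm *)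

(** Pushed items go directly to the input cells of the second memory, so no query is ever copied.
    Cell 0 stays 0 until [Ask] writes the length there. *)
Definition tape_memory (tp : word) (a : int) : int :=
  if a is Posz i.+1 then tp`_i else 0.

(* Computes 1 + y - y^2 in register 4, positive exactly for y = 0, 1, from the
   result y of the inner run, and prepares the next simulated query. *)
Definition collect : seq macro :=
  [:: MConst 2 0; MLoad false 3 2; MErase; MNext; MConst 0 0;
      MArith Mul 4 3 3; MArith Defs.Sub 4 3 4; MConst 2 1; MArith Add 4 4 2].

Definition push_macros (x : int) : seq macro :=
  read true 3 x ++ [:: MConst 4 1; MArith Add 0 0 4; MStore false 0 3].

(** On a dead simulation the tested register becomes 0, which ends the loop. *)
Definition guard (x : int) : prog :=
  IfPos (reg 1) (block (read true 3 x)) (Instr (Const (reg 3) 0)).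

(** The second memory doubles as the tape of r, so [Erase] blanks it. The flag in register 1 is
    tested where the program continues after a part that may have died: in a sequence and in a
    loop. *)
Fixpoint compose (r q : prog) : prog :=
  match r with
  | Instr (Ask x) =>
      Then (block [:: MConst 2 0; MStore false 2 0])
        (Then (compile q)
           (Then (block collect)
              (IfPos (reg 4) (block (save true x 3))
                 (Instr (Const (reg 1) 0)))))
  | Instr (Push x) => block (push_macros x)
  | Instr Erase => block [:: MConst 0 0; MNext]
  | Instr i => block (memory_macros true i)
  | Then r1 r2 =>
      Then (compose r1 q) (IfPos (reg 1) (compose r2 q) (block [::]))
  | IfPos x r1 r2 =>
      Then (block (read true 3 x))
        (IfPos (reg 3) (compose r1 q) (compose r2 q))
  | WhilePos x r1 =>
      Then (guard x) (WhilePos (reg 3) (Then (compose r1 q) (guard x)))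
  end.

Lemma deterministic_compile q : deterministic q -> deterministic (compile q).
Proof.
elim: q => [i|p1 IH1 p2 IH2|x p1 IH1 p2 IH2|x p IH] /=.
- by case: i.
- by move=> /andP[/IH1 -> /IH2 ->].
- by move=> /andP[/IH1 -> /IH2 ->].
by move=> /IH ->.
Qed.

Lemma deterministic_compose r q :
  deterministic r -> deterministic q -> deterministic (compose r q).
Proof.
move=> det_r /deterministic_compile det_q.
elim: r det_r => [i|p1 IH1 p2 IH2|x p1 IH1 p2 IH2|x p IH] /=.
- by case: i => //= x; rewrite det_q.
- by move=> /andP[/IH1 -> /IH2 ->].
- by move=> /andP[/IH1 -> /IH2 ->].
by move=> /IH ->.
Qed.

Definition finish_macros : seq macro :=
  read true 3 0 ++ [:: MConst 4 1, MArith Defs.Sub 3 4 3 & save true 0 3].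

(* The output is the negation of the answer of r, or 2 if a run of q gave up. *)
Definition negated_compose (r q : prog) : prog :=
  Then (Instr (Const stamp_cell 1))
    (Then (block [:: MConst 1 1])
       (Then (compose r q)
          (IfPos (reg 1) (block finish_macros) (Instr (Const 0 2))))).

Lemma deterministic_negated_compose r q :
  deterministic r -> deterministic q -> deterministic (negated_compose r q).
Proof. by move=> det_r det_q; rewrite /= deterministic_compose. Qed.

(** * Invariants of the composed program *)

Section Outer.
Variables (A : problem) (O : word -> int) (q : prog) (legal : word -> Prop).
Variables (tau : word -> nat) (K W T : nat).
Hypothesis K_gt0 : (0 < K)%N.
Hypothesis small : forall v, legal v -> (bitlen (O v) <= K * (size v).+1)%N.
Hypothesis weight_q : (weight q <= W)%N.
Hypothesis q_sound : forall w g, instance A w -> exists s,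
  [/\ exec O q (init w g) s, (clock s <= tau w)%N,
      forall v, v \in queries s -> legal v
    & result s \in [:: 0; 1] -> result s = answer A w].
Hypothesis q_complete : forall w, instance A w -> exists g s,
  exec O q (init w g) s /\ result s = answer A w.

(** Stamps and tape lengths never exceed T + 1; this is the logarithmic overhead. *)
Let L := bitlen T.+1.
Let N := (W + L + K)%N.
Let slowdown := (200 * (100 * N))%N.

(** The measure in which the simulation is linear: the clock of r charges a query by its length, and
    [tau] adds the inner run. *)
Definition work (s : state) : nat :=
  (clock s + \sum_(v <- queries s) tau v)%N.

(** The real tape belongs to q and is empty between its runs. The stamp starts at 1 and rises by 1
    at [Erase] and [Ask], both of positive cost, so the clock bounds it. *)
Record outer (x : config) (s : state) : Prop := {
  outer_mem : cmem x true =1 memory s;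
  outer_query : cmem x false =1 tape_memory (tape s);
  outer_size : regs x 0 = size (tape s);
  outer_alive : regs x 1 = 1;
  outer_tape : ctape x = [::];
  outer_stamp : (stamp x <= (clock s).+1)%N;
  outer_clock : (size (tape s) <= clock s)%N;
  outer_legal : forall v, v \in cqueries x -> legal v
}.

Definition alive (t s : state) : Prop :=
  exists x, represents t x /\ outer x s.

(** Of a dead run nothing is asked but to stop in time with legal queries. *)
Definition dead (t : state) : Prop :=
  memory t (reg 1) = 0 /\ forall v, v \in queries t -> legal v.

Lemma exec_work p s1 s2 : exec (answer A) p s1 s2 -> (work s1 < work s2)%N.
Proof.
rewrite /work; elim=> {p s1 s2} //=.
- move=> i s; have := instr_cost_gt0 i s.
  have -> : clock (instr_effect (answer A) i s) = clock s by case: (i).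
  suff : (\sum_(v <- queries s) tau v <=
          \sum_(v <- queries (instr_effect (answer A) i s)) tau v)%N by lia.
  by case: i => *; rewrite //= big_rcons /=; lia.
- lia.
- move=> *; lia.
- move=> *; lia.
- move=> x p s _; have := bitlen_gt0 (memory s x); lia.
move=> *; lia.
Qed.

Lemma outer_L x s : outer x s -> (clock s <= T)%N ->
  (bitlen (stamp x) <= L)%N /\ (bitlen (size (tape s)) <= L)%N.
Proof. by move=> [] *; split; apply: bitlen_nat; lia. Qed.

Lemma answer_01 w : answer A w \in [:: 0; 1].
Proof. by rewrite /answer; case: (boolp.asbool _). Qed.

(** Soundness on all streams and the existence of a lucky one, in one induction. The lucky g1 can
    precede t1 in the quantifiers, since good guesses depend only on the queries of r; it is built
    backwards from g2, so that the streams of successive parts fit together. The 2 leaves room for a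
    flag test between them. *)
Definition simulates p (s1 s2 : state) : Prop :=
  forall g2, exists g1, forall t1, alive t1 s1 -> exists t2,
  [/\ exec O (compose p q) t1 t2,
      (clock t2 + slowdown * work s1 + 2 <= clock t1 + slowdown * work s2)%N,
      alive t2 s2 \/ dead t2
    & guesses t1 = g1 -> alive t2 s2 /\ guesses t2 = g2].

Lemma block_simulates i l s :
    compose (Instr i) q = block l ->
    queries (instr_effect (answer A) i s) = queries s ->
    (forall x, outer x s ->
     let x' := mrun O l x in
     [/\ outer x' (tick (instr_cost i s) (instr_effect (answer A) i s)),
         cguesses x' = cguesses x
       & (total_mcost O l x <= 20 * N * instr_cost i s)%N]) ->
  simulates (Instr i) s (tick (instr_cost i s) (instr_effect (answer A) i s)).
Proof.
move=> eq_l eq_q step g2; exists g2 => t1 [x1 [rep1 out1]].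
have [out2 eq_g cost] := step x1 out1.
have [t2 [run2 rep2 c2]] := block_exec O l rep1.
have alive2 : alive t2 (tick (instr_cost i s) (instr_effect (answer A) i s)).
  by exists (mrun O l x1).
exists t2; split=> //; first by rewrite eq_l.
- rewrite /work /= eq_q.
  have -> : clock (instr_effect (answer A) i s) = clock s by case: (i).
  have : (0 < N * instr_cost i s)%N.
    by rewrite muln_gt0 instr_cost_gt0 /N; lia.
  by rewrite /slowdown; nia.
- by left.
by rewrite (represents_guesses rep2) eq_g -(represents_guesses rep1).
Qed.

Lemma memory_simulates i s : is_memory i -> (weight (Instr i) <= W)%N ->
  (clock s <= T)%N ->
  simulates (Instr i) s (tick (instr_cost i s) (instr_effect (answer A) i s)).
Proof.
move=> mem_i le_W le_T; apply: (@block_simulates i (memory_macros true i)).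
- by case: i mem_i {le_W}.
- by case: i mem_i {le_W}.
move=> x out; have [st_le _] := outer_L out le_T.
case: out => eq_M eq_q eq_sz eq_al eq_tp eq_st eq_ck leg.
have [eq_mem eqR [eq_r eq_st' eq_tp' eq_g' eq_q'] cost_le] :=
  memory_macros_correct O mem_i eq_M.
have [tape_i clock_i] : tape (instr_effect (answer A) i s) = tape s /\
    clock (instr_effect (answer A) i s) = clock s.
  by case: i mem_i {le_W eq_mem eqR eq_r eq_st' eq_tp' eq_g' eq_q' cost_le}.
split=> //.
- split=> //=; rewrite ?tape_i ?clock_i ?eq_r ?eq_tp' ?eq_q' ?eq_st' //.
  + by move=> a; rewrite eq_mem; case: i mem_i {le_W cost_le eq_mem eqR eq_r eq_st' eq_tp' eq_g' eq_q' tape_i clock_i}.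
  + by rewrite (eqR : cmem _ false = _).
  + by lia.
  by lia.
have := instr_cost_gt0 i s; rewrite /N; nia.
Qed.

Lemma push_simulates y s : (bitlen y <= W)%N -> (clock s <= T)%N ->
  simulates (Instr (Push y)) s
    (tick (instr_cost (Push y) s) (instr_effect (answer A) (Push y) s)).
Proof.
move=> le_W le_T; apply: (@block_simulates _ (push_macros y)) => // x out.
have [st_le sz_le] := outer_L out le_T.
case: x out st_le => M r st tp g qs [] /= eq_M eq_q eq_sz eq_al eq_tp eq_st eq_ck leg st_le.
split=> //=.
- split=> //=.
  + move=> a; rewrite /write eq_M eq_sz /arith_eval; case: eqP => [->|ne] /=.
      by rewrite addn1 /= nth_rcons ltnn eqxx.
    rewrite eq_q /tape_memory; case: a ne => [[|i]|i] //= ne.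
    rewrite nth_rcons; case: ltngtP => // [lt_i|eq_i].
      by rewrite nth_default // ltnW.
    by case: ne; rewrite eq_i /arith_eval; lia.
  + by rewrite /arith_eval eq_sz size_rcons; lia.
  + by have := bitlen_gt0 (memory s y); lia.
  by rewrite size_rcons; have := bitlen_gt0 (memory s y); lia.
rewrite /mcost /= eq_M eq_sz bitlen_literals /N.
have := bitlen_arith Add (size (tape s)) 1; rewrite bitlen_literals.
have c_gt0 := bitlen_gt0 (memory s y).
have : (bitlen (memory s y) <= N * bitlen (memory s y))%N.
  by rewrite leq_pmull // /N; lia.
have : (N <= N * bitlen (memory s y))%N by rewrite leq_pmulr.
by rewrite /N; lia.
Qed.

Lemma erase_simulates s : (clock s <= T)%N ->
  simulates (Instr Erase) s
    (tick (instr_cost Erase s) (instr_effect (answer A) Erase s)).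
Proof.
move=> le_T; apply: (@block_simulates _ [:: MConst 0 0; MNext]) => // x out.
have [st_le sz_le] := outer_L out le_T.
case: x out st_le => M r st tp g qs [] /= eq_M eq_q eq_sz eq_al eq_tp eq_st eq_ck leg st_le.
split=> //=.
- split=> //=; last by lia.
  by case=> [[|i]|i]; rewrite /= ?nth_nil.
by rewrite /mcost /= bitlen_literals /N; lia.
Qed.

Lemma ask_simulates y s : (bitlen y <= W)%N -> (clock s <= T)%N ->
    instance A (tape s) ->
  simulates (Instr (Ask y)) s
    (tick (instr_cost (Ask y) s) (instr_effect (answer A) (Ask y) s)).
Proof.
move=> le_W le_T inst g2.
set s2 := tick _ _.
have [g' [s' [run' res']]] := q_complete inst.
(* The successful run of q is given a stream that leaves exactly g2 unread. *)
have [g1 [_ run1]] := exec_reguess run' g2.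
exists g1 => t1 [x1 [rep1 out1]].
have [st_le sz_le] := outer_L out1 le_T.
have [eq_M eq_q eq_sz eq_al eq_tp eq_st eq_ck leg] := out1.
have [ta [runa repa ca]] := block_exec O [:: MConst 2 0; MStore false 2 0] rep1.
have {ca} ca : (clock ta <= clock t1 + 200 * (2 * N + 3))%N.
  apply: leq_trans ca _; rewrite leq_add2l leq_mul2l /=.
  case: (x1) st_le eq_sz => M r st tp g qs /= st_le eq_sz.
  by rewrite /mcost /= eq_sz bitlen_literals /N; lia.
set xa := mrun _ _ _ in repa.
(* Soundness is applied to the stream that the machine really holds, lucky or not. *)
have [sa [runA time_A legal_A res_A]] := q_sound (cguesses xa) inst.
have ina : inner L (cqueries x1) xa (init (tape s) (cguesses xa)).
  rewrite /xa; case: (x1) eq_q eq_sz eq_tp st_le => M r st tp g qs /= eq_q eq_sz eq_tp st_le.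
  split=> //=; last by rewrite cats0.
  move=> a; rewrite /write eq_sz eq_q; case: a => [[|i]|i] //=.
have [v0 vq|tb [xb [runb repb inb frb cb]]] :=
  compile_correct K_gt0 runA weight_q _ repa ina.
  by apply: small; exact: legal_A.
(* Cell 0 starts with the length of the query, of at most L bits, and grows at most K bits per unit
   of time. *)
have res_bits : (bitlen (result sa) <= L + K * tau (tape s))%N.
  have := exec_bitlen K_gt0 runA (fun v0 vq => small (legal_A v0 vq)) 0.
  have : (K * clock sa <= K * tau (tape s))%N by rewrite leq_mul2l time_A orbT.
  by rewrite /= /result; lia.
have [tc [runc repc cc]] := block_exec O collect repb.
set xc := mrun _ _ _ in repc.
have eq_res : cmem xb false 0 = result sa by rewrite (inner_mem inb).
have {cc} cc : (clock tc <= clock tb + 200 * (20 * (L + L + K * tau (tape s) + 2)))%N.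
  apply: leq_trans cc _; rewrite leq_add2l leq_mul2l /=.
  have := inner_stamp inb; move: eq_res res_bits.
  case: (xb) => M r st tp g qs /= -> res_bits st_b.
  rewrite /mcost /=; bound_bitlens; rewrite !bitlen_literals; lia.
have eq4 : memory tc (reg 4) = 1 + result sa - result sa * result sa.
  rewrite (represents_reg repc) /xc; case: (xb) eq_res => M r st tp g qs /= ->.
  by rewrite /arith_eval; lia.
have [frm frr frs] := frb.
have xcE : [/\ cmem xc true =1 memory s, cmem xc false =1 (fun=> 0),
    [/\ regs xc 0 = 0, regs xc 1 = 1 & regs xc 3 = result sa],
    stamp xc = (stamp x1).+1 /\ ctape xc = [::]
  & cguesses xc = guesses sa /\ cqueries xc = cqueries x1 ++ queries sa].
  have gb := inner_guesses inb; have qb := inner_queries inb.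
  have r1 := frr 1%N isT.
  rewrite /xc; case: (xb) frm frs r1 gb qb eq_res => M r st tp g qs /=.
  rewrite /xa; case: (x1) eq_M eq_al => M1 r' st1 tp1 g0 qs1 /=.
  by move=> eq_M eq_al -> -> -> -> -> ->; split; rewrite ?eq_al.
have [xc_R xc_A [xc_0 xc_1 xc_3] [xc_st xc_tp] [xc_g xc_q]] := xcE.
have legal_c v : v \in cqueries xc -> legal v.
  by rewrite xc_q mem_cat => /orP[/leg|/legal_A].
have finish t2 : exec O (IfPos (reg 4) (block (save true y 3))
       (Instr (Const (reg 1) 0))) tc t2 -> exec O (compose (Instr (Ask y)) q) t1 t2.
  by move=> run; apply: ExecThen runa (ExecThen runb (ExecThen runc run)).
have test_bits : (bitlen (memory tc (reg 4)) <= 1 + 3 * bitlen (result sa))%N.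
  rewrite eq4.
  have -> : 1 + result sa - result sa * result sa = arith_eval Defs.Sub
    (arith_eval Add 1 (result sa)) (arith_eval Mul (result sa) (result sa)) by [].
  bound_bitlens; rewrite bitlen_literals; lia.
have in_time t2 : (clock t2 <= clock tc + bitlen (memory tc (reg 4)) +
                     200 * (2 * N + 3))%N ->
    (clock t2 + slowdown * work s + 2 <= clock t1 + slowdown * work s2)%N.
  have le_P : (N * clock sa <= N * tau (tape s))%N by rewrite leq_mul2l time_A orbT.
  have le_E : (K * tau (tape s) <= N * tau (tape s))%N.
    by rewrite leq_mul2r /N leq_addl orbT.
  have -> : work s2 = (work s + (size (tape s)).+1 + tau (tape s))%N.
    by rewrite /work /= big_rcons /=; lia.
  have L_gt0 : (0 < L)%N by [].
  have : (N <= N * (size (tape s)).+1)%N by rewrite leq_pmulr.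
  move: cb; rewrite /= -/N muln0 /slowdown => cb N_le t2_le.
  have : (2 <= N)%N by rewrite /N; lia.
  have : (L <= N)%N by rewrite /N; lia.
  lia.
case: (boolP (result sa \in [:: 0; 1])) => [res01|resN].
  pose tc' := tick (bitlen (memory tc (reg 4))) tc.
  have repc' : represents tc' xc by case: repc.
  have [t2 [run2 rep2 c2]] := block_exec O (save true y 3) repc'.
  have alive2 : alive t2 s2.
    exists (mrun O (save true y 3) xc); split => //.
    have eq_ans := res_A res01; rewrite eq_ans in xc_3.
    case: (xc) xc_R xc_A xc_0 xc_1 xc_3 xc_st xc_tp legal_c => M r st tp g qs /=
      xc_R xc_A xc_0 xc_1 xc_3 xc_st xc_tp legal_c.
    split=> //=.
    + by rewrite xc_3; exact: eq_write.
    + by move=> a; rewrite xc_A; case: a => [[|i]|i]; rewrite /= ?nth_nil.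
    by rewrite xc_st; lia.
  exists t2; split=> //.
  - apply: finish; apply: ExecIfTrue run2; rewrite eq4.
    by move: res01; rewrite !inE => /orP[] /eqP ->.
  - apply: in_time; apply: leq_trans c2 _; rewrite leq_add2l leq_mul2l /=.
    have : (bitlen (stamp xc) <= L + 1)%N.
      have := @absz_add_bitlen (stamp x1) 1 (stamp x1).+1.
      by rewrite xc_st bitlen_literals; lia.
    have res_small : bitlen (result sa) = 1%N.
      by move: res01; rewrite !inE => /orP[] /eqP ->.
    move: xc_3; case: (xc) => M r st tp g qs /= ->.
    by rewrite /mcost /= res_small /N; lia.
  - by left.
  move=> eq_g1; split => //.
  have xa_g1 : cguesses xa = g1.
    by rewrite -eq_g1 (represents_guesses rep1) /xa; case: (x1).
  rewrite (represents_guesses rep2); have -> : cguesses (mrun O (save true y 3) xc) = cguesses xc.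
    by case: (xc).
  rewrite xc_g.
  rewrite xa_g1 in runA.
  by rewrite (exec_functional runA run1).
exists (tick (bitlen (memory tc (reg 4)) + bitlen 0) (set_mem (reg 1) 0 tc)).
split.
- apply: finish; apply: ExecIfFalse.
    rewrite eq4; move: resN; rewrite !inE negb_or => /andP[/eqP ne0 /eqP ne1]; nia.
  have := ExecInstr O (Const (reg 1) 0) (tick (bitlen (memory tc (reg 4))) tc).
  by rewrite /tick /= addnA.
- by apply: in_time; rewrite /= bitlen_literals; lia.
- right; split; first by rewrite /= write_same.
  by move=> v; rewrite /= (represents_queries repc) => /legal_c.
(* On the lucky stream this is the run given by completeness, whose result is 0 or 1. *)
move=> eq_g1; case/negP: resN.
have xa_g1 : cguesses xa = g1.
  by rewrite -eq_g1 (represents_guesses rep1) /xa; case: (x1).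
rewrite xa_g1 in runA; rewrite (exec_functional runA run1).
by rewrite /result /= -/(result s') res' answer_01.
Qed.

Lemma alive_tick c t s : alive t s -> alive (tick c t) s.
Proof. by move=> [x [rep out]]; exists x; split=> //; case: rep. Qed.

Lemma alive_advance c t s : alive t s -> alive t (tick c s).
Proof.
move=> [x [rep [eq_M eq_q eq_sz eq_al eq_tp eq_st eq_ck leg]]].
by exists x; split=> //; split=> //=; lia.
Qed.

Lemma alive_flag t s : alive t s -> memory t (reg 1) = 1.
Proof. by move=> [x [rep out]]; rewrite (represents_reg rep) (outer_alive out). Qed.

Lemma read_alive y t s : alive t s -> (bitlen y <= W)%N -> (clock s <= T)%N ->
  exists t', [/\ exec O (block (read true 3 y)) t t', alive t' s,
    memory t' (reg 3) = memory s y, guesses t' = guesses t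
  & (clock t' <= clock t + 200 * (2 * N + bitlen (memory s y) + 1))%N].
Proof.
move=> [x [rep out]] le_W le_T; have [st_le _] := outer_L out le_T.
have [t' [run rep' cost]] := block_exec O (read true 3 y) rep.
exists t'; split=> //.
- exists (mrun O (read true 3 y) x); split => //.
  by case: out; case: (x).
- by rewrite (represents_reg rep'); case: out; case: (x) => /= *.
- by rewrite (represents_guesses rep') (represents_guesses rep); case: (x).
apply: leq_trans cost _; rewrite leq_add2l leq_mul2l /=.
case: out st_le; case: (x) => M r st tp g qs /= eq_M *.
by rewrite /mcost /= eq_M /N; lia.
Qed.

Lemma guard_alive y t s : alive t s -> (bitlen y <= W)%N -> (clock s <= T)%N ->
  exists t', [/\ exec O (guard y) t t', alive t' s,
    memory t' (reg 3) = memory s y, guesses t' = guesses t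
  & (clock t' <= clock t + 1 + 200 * (2 * N + bitlen (memory s y) + 1))%N].
Proof.
move=> al le_W le_T; have flag := alive_flag al.
have [t' [run al' eq3 eq_g cost]] :=
  read_alive (alive_tick (bitlen (memory t (reg 1))) al) le_W le_T.
exists t'; split=> //; first by apply: ExecIfTrue run; rewrite flag.
by rewrite /= flag bitlen_literals in cost; lia.
Qed.

Lemma guard_dead y t : dead t -> exists t',
  [/\ exec O (guard y) t t', dead t', memory t' (reg 3) = 0
    & clock t' = (clock t + 2)%N].
Proof.
move=> [flag legal_t].
exists (tick (bitlen 0) (set_mem (reg 3) 0 (tick (bitlen (memory t (reg 1))) t))).
split=> //=; last by rewrite flag bitlen_literals; lia.
by apply: ExecIfFalse; [rewrite flag | apply: ExecInstr].
Qed.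

Lemma simulates_exec p s1 s2 : exec (answer A) p s1 s2 ->
    deterministic p -> (weight p <= W)%N -> (clock s2 <= T)%N ->
    (forall v, v \in queries s2 -> instance A v) ->
  simulates p s1 s2.
Proof.
have S_ge : (1000 * N + 1000 <= slowdown)%N by rewrite /slowdown /N; lia.
elim=> {p s1 s2}.
- move=> i s det_i le_W /= le_T insts.
  have clock_i : clock (instr_effect (answer A) i s) = clock s by case: (i).
  have {}le_T : (clock s <= T)%N by rewrite clock_i in le_T; lia.
  case: (boolP (is_memory i)) => [mem_i|]; first exact: memory_simulates.
  case: i det_i le_W insts {clock_i} => //= [y _ le_W insts|_ le_W insts|y _ le_W insts] _.
  + exact: push_simulates.
  + exact: erase_simulates.
  by apply: ask_simulates => //; apply: insts; rewrite /= mem_rcons inE eqxx.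
- move=> p1 p2 s1 s2 s3 run1 IH1 run2 IH2 /= /andP[det1 det2] le_W le_T insts g3.
  have [||||g2 sim2] := IH2 _ _ _ _ g3 => //; first by lia.
  have lt_c := exec_clock run2; have lt_w := exec_work run2.
  have [|||v vq|g1 sim1] := IH1 _ _ _ _ g2; try by [|lia].
    by apply: insts; apply: exec_queries run2 _ _.
  exists g1 => t1 al1; have [t2 [crun1 c1 state2 luck1]] := sim1 t1 al1.
  case: state2 => [al2|[flag leg2]].
    have flag := alive_flag al2.
    have [t3 [crun2 c2 state3 luck2]] :=
      sim2 _ (alive_tick (bitlen (memory t2 (reg 1))) al2).
    exists t3; split=> //.
    + by apply: ExecThen crun1 _; apply: ExecIfTrue crun2; rewrite flag.
    + by rewrite /= flag bitlen_literals in c2; lia.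
    by move=> /luck1 [_ eq_g2]; apply: luck2.
  set t2' := tick (bitlen (memory t2 (reg 1))) t2.
  exists (tick (bitlen 0) (set_mem tmp1 0 t2')); split.
  + apply: ExecThen crun1 _; apply: ExecIfFalse; first by rewrite flag.
    exact: ExecInstr.
  (* The skipped part has positive work, and one unit of it pays for the exit. *)
  + have : (slowdown * (work s2).+1 <= slowdown * work s3)%N by rewrite leq_mul2l lt_w orbT.
    by rewrite /= flag bitlen_literals mulnS; lia.
  + by right; split; rewrite //= write_other.
  move=> /luck1 [[x [rep out]] _].
  by move: flag; rewrite (represents_reg rep) (outer_alive out).
- move=> y p1 p2 s1 s2 y_gt0 run IH /= /andP[det1 det2] le_W le_T insts g2.
  have lt_c := exec_clock run; have b_gt0 := bitlen_gt0 (memory s1 y).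
  rewrite /= in lt_c.
  have [||||g1 sim] := IH _ _ _ _ g2 => //; first by lia.
  exists g1 => t1 al1.
  have [||t1' [crun1 al1' eq3 eq_g c1]] := read_alive al1 (y := y); try by lia.
  set b := bitlen (memory s1 y) in b_gt0 c1 run sim lt_c.
  have [t2 [crun2 c2 state2 luck2]] := sim _ (alive_tick b (alive_advance b al1')).
  exists t2; split=> //.
  + by apply: ExecThen crun1 _; apply: ExecIfTrue; rewrite eq3.
  + have : (slowdown <= slowdown * b)%N by rewrite leq_pmulr.
    have : (N <= N * b)%N by rewrite leq_pmulr.
    have : (b <= N * b)%N by rewrite leq_pmull // /N; lia.
    move: c2; rewrite /work /=; rewrite /slowdown in S_ge *; lia.
  by move=> eq_g1; apply: luck2; rewrite /= eq_g.
- move=> y p1 p2 s1 s2 y_le0 run IH /= /andP[det1 det2] le_W le_T insts g2.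
  have lt_c := exec_clock run; have b_gt0 := bitlen_gt0 (memory s1 y).
  rewrite /= in lt_c.
  have [||||g1 sim] := IH _ _ _ _ g2 => //; first by lia.
  exists g1 => t1 al1.
  have [||t1' [crun1 al1' eq3 eq_g c1]] := read_alive al1 (y := y); try by lia.
  set b := bitlen (memory s1 y) in b_gt0 c1 run sim lt_c.
  have [t2 [crun2 c2 state2 luck2]] := sim _ (alive_tick b (alive_advance b al1')).
  exists t2; split=> //.
  + by apply: ExecThen crun1 _; apply: ExecIfFalse; rewrite eq3.
  + have : (slowdown <= slowdown * b)%N by rewrite leq_pmulr.
    have : (N <= N * b)%N by rewrite leq_pmulr.
    have : (b <= N * b)%N by rewrite leq_pmull // /N; lia.
    move: c2; rewrite /work /=; rewrite /slowdown in S_ge *; lia.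
  by move=> eq_g1; apply: luck2; rewrite /= eq_g.
- move=> y p s y_le0 /= det le_W le_T insts g2.
  exists g2 => t1 al1.
  have [||t1' [crun1 al1' eq3 eq_g c1]] := guard_alive al1 (y := y); try by lia.
  set b := bitlen (memory s y) in c1 le_T *.
  have al2 : alive (tick b t1') (tick b s) by apply/alive_tick/alive_advance.
  exists (tick b t1'); split=> //.
  + apply: ExecThen crun1 _.
    by rewrite /b -eq3; apply: ExecWhileStop; rewrite eq3.
  + have b_gt0 : (0 < b)%N by [].
    have : (N <= N * b)%N by rewrite leq_pmulr.
    have : (b <= N * b)%N by rewrite leq_pmull // /N; lia.
    rewrite /work /= /slowdown; lia.
  + by left.
  by rewrite /= eq_g.
move=> y p s1 s2 s3 y_gt0 run1 IH1 run2 IH2 /= det le_W le_T insts g3.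
have [||||g2 sim2] := IH2 _ _ _ _ g3 => //.
have lt_c1 := exec_clock run1; rewrite /= in lt_c1.
have lt_c := exec_clock run2; have lt_w := exec_work run2.
have [|||v vq|g1 sim1] := IH1 _ _ _ _ g2; try by [|lia].
  by apply: insts; apply: exec_queries run2 _ _.
exists g1 => t1 al1.
have [||t1' [crun1 al1' eq3 eq_g c1]] := guard_alive al1 (y := y); try by lia.
set b := bitlen (memory s1 y) in c1 run1 sim1 lt_c1.
have [t2 [crun2 c2 state2 luck2]] := sim1 _ (alive_tick b (alive_advance b al1')).
have work_tick : work (tick b s1) = (work s1 + b)%N by rewrite /work /=; lia.
rewrite {}work_tick mulnDr /= in c2.
have b_gt0 : (0 < b)%N by [].
have test_cost : (200 * (2 * N + b + 1) + b + 10 <= slowdown * b)%N.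
  have : (N <= N * b)%N by rewrite leq_pmulr.
  have : (b <= N * b)%N by rewrite leq_pmull // /N; lia.
  by rewrite /slowdown; lia.
have enter t4 t5 : exec O (guard y) t2 t4 -> exec O (WhilePos (reg 3) (Then (compose p q) (guard y))) t4 t5 ->
    exec O (compose (WhilePos y p) q) t1 t5.
  move=> read_run loop_run; apply: ExecThen crun1 _.
  apply: ExecWhileStep loop_run; first by rewrite eq3.
  by apply: ExecThen read_run; rewrite eq3.
case: state2 => [al2|dead2].
  have [t3 [crun3 c3 state3 luck3]] := sim2 t2 al2.
  exists t3; split=> //.
  - inversion crun3 as [|? ? ? t4 ? crun_read crun_loop| | | |]; subst.
    exact: enter crun_read crun_loop.
  - by lia.
  by move=> eq_g1; apply: luck3; apply luck2; rewrite /= eq_g.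
have [t4 [crun4 [flag4 leg4] zero4 c4]] := guard_dead y dead2.
exists (tick (bitlen 0) t4); split.
- apply: enter crun4 _; rewrite -zero4; apply: ExecWhileStop; by rewrite zero4.
- have : (slowdown * (work s2).+1 <= slowdown * work s3)%N by rewrite leq_mul2l lt_w orbT.
  by rewrite /= bitlen_literals mulnS; lia.
- by right; split.
move=> eq_g1; have [|/alive_flag flag2 _] := luck2; first by rewrite /= eq_g.
by case: dead2; rewrite flag2.
Qed.

Lemma alive_start w g : exists t,
  [/\ exec O (Then (Instr (Const stamp_cell 1)) (block [:: MConst 1 1])) (init w g) t,
      forall g', alive t (init w g'), guesses t = g & (clock t <= 401)%N].
Proof.
pose x0 := Config (fun u => if u then memory (init w g) else fun=> 0) (fun=> 0)
  1 [::] g [::].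
pose t0 := tick (bitlen 1) (set_mem stamp_cell 1 (init w g)).
have init_neg a : a < 0 -> memory (init w g) a = 0 by case: a.
have rep0 : represents t0 x0.
  have mem0 b : b <> stamp_cell -> memory t0 b = memory (init w g) b.
    exact: write_other.
  split=> // [a|a|j].
  - have [_ _ _ ne _] := cellR_not_tmp a; rewrite mem0 //.
    have [[_ ->]//|[a_lt0 ->]] := cellR_cases a.
    by transitivity (0 : int); [|symmetry]; apply: init_neg; lia.
  - have [_ _ _ ne _] := stampA_not_tmp a; have [_ _ _ ne' _] := cellA_not_tmp a.
    have [k off_a] := offsetA_ge0 a.
    exists 0%N => //; split=> //; rewrite mem0 //.
    by rewrite init_neg // /stampA off_a; lia.
  rewrite mem0; last by rewrite /stamp_cell /reg; lia.
  by rewrite init_neg // /reg; lia.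
have [t [run rep cost]] := block_exec O [:: MConst 1 1] rep0.
exists t; split.
- by apply: ExecThen run; apply: ExecInstr.
- move=> g'; exists (mrun O [:: MConst 1 1] x0); split=> //; split=> //=.
  by case=> [[|i]|i]; rewrite /= ?nth_nil.
- by rewrite (represents_guesses rep).
by move: cost; rewrite /= /mcost /= !bitlen_literals.
Qed.

Lemma negated_compose_correct r w g0 s :
    exec (answer A) r (init w g0) s -> deterministic r -> (weight r <= W)%N ->
    (clock s <= T)%N -> (forall v, v \in queries s -> instance A v) ->
    result s \in [:: 0; 1] ->
  exists g1, forall g, exists t,
    [/\ exec O (negated_compose r q) (init w g) t,
        (clock t <= slowdown * (work s + 1))%N,
        forall v, v \in queries t -> legal v,
        result t \in [:: 0; 1] -> result t = 1 - result s
      & g = g1 -> result t = 1 - result s].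
Proof.
move=> run det_r le_W le_T insts res01.
have [g1 sim] := simulates_exec run det_r le_W le_T insts (fun=> false).
exists g1 => g; have [t0 [run0 al0 eq_g c0]] := alive_start w g.
have [t1 [run1 c1 state1 luck]] := sim t0 (al0 g0).
rewrite /work /= big_nil addn0 muln0 in c1.
have glue t2 : exec O (IfPos (reg 1) (block finish_macros) (Instr (Const 0 2))) t1 t2 ->
    exec O (negated_compose r q) (init w g) t2.
  move=> run2; inversion run0 as [|? ? ? s' ? run_c run_b| | | |]; subst.
  exact: ExecThen run_c (ExecThen run_b (ExecThen run1 run2)).
have N_gt1 : (1 < N)%N by rewrite /N; have := bitlen_gt0 T.+1; rewrite -/L; lia.
have room : (clock t1 + 4000 * N <= slowdown * (work s + 1))%N.
  by rewrite mulnDr muln1 /work [in X in (_ <= _ + X)%N]/slowdown; lia.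
case: state1 => [al1|[flag leg1]].
  have flag := alive_flag al1.
  have [x [rep out]] := alive_tick (bitlen (memory t1 (reg 1))) al1.
  have [st_le _] := outer_L out le_T.
  have [t2 [run2 rep2 c2]] := block_exec O finish_macros rep.
  have x_res : cmem (mrun O finish_macros x) true 0 = 1 - result s.
    by case: out; case: (x) => M * /=; rewrite write_same /arith_eval -/(result s); congr (_ - _).
  have res2 : result t2 = 1 - result s.
    by rewrite -x_res -(represents_R rep2) /cellR mul0r.
  exists t2; split=> //.
  - by apply: glue; apply: ExecIfTrue run2; rewrite flag.
  - have ct : clock (tick (bitlen (memory t1 (reg 1))) t1) = (clock t1 + 1)%N.
      by rewrite /= flag.
    have : (total_mcost O finish_macros x <= 10 * N + 10)%N.
      have res1 : bitlen (result s) = 1%N by move: res01; rewrite !inE => /orP[] /eqP ->.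
      have res3 : bitlen (1 - result s) = 1%N by move: res01; rewrite !inE => /orP[] /eqP ->.
      case: out st_le; case: (x) => M rg st tp gs qs /= eq_M *.
      by rewrite /mcost /= eq_M -/(result s) res1 /arith_eval res3 !bitlen_literals /N; lia.
    by lia.
  move=> v; rewrite (represents_queries rep2) => vq; apply: (outer_legal out).
  by case: (x) vq.
exists (tick (bitlen 2) (set_mem 0 2 (tick (bitlen (memory t1 (reg 1))) t1))).
split=> //.
- by apply: glue; apply: ExecIfFalse; [rewrite flag | apply: ExecInstr].
- by apply: leq_trans room; rewrite /= flag !bitlen_literals; lia.
move=> eq_g1; have [|/alive_flag flag1 _] := luck; first by rewrite eq_g.
by rewrite flag in flag1.
Qed.
End Outer.

(** * Size of the answers of a polynomial oracle *)

(** The exponent 1 gives b s <= s for large s; the finitely many remaining values are summed into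
    B. *)
Lemma subpolynomial_linear (R : realType) b : subpolynomial R b ->
  exists B, forall s, (b s <= s + B)%N.
Proof.
move=> sub_b; have [N le_b] := sub_b 1 ltr01.
exists (\sum_(s < N) b s)%N => s; case: (ltnP s N) => [lt_s|le_s].
  by rewrite (bigD1 (Ordinal lt_s)) //= addnCA leq_addr.
apply: leq_trans (leq_addr _ _).
by have := le_b s le_s; rewrite powRr1 ?ler0n // ler_nat.
Qed.

(** Exponent vectors of degree at most D are functions into D + 1 values. The count is exponential
    in n, but only its length, linear in n, matters. *)
Lemma size_msupp_le n (p : {mpoly int[n]}) D :
  (msize p <= D.+1)%N -> (size (msupp p) <= D.+1 ^ n)%N.
Proof.
move=> le_D.
pose exps (m : 'X_{1..n}) : {ffun 'I_n -> 'I_D.+1} :=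
  [ffun i => inord (m i)].
rewrite -(size_map exps) -[n in (_ ^ n)%N]card_ord -[D.+1 in X in (_ <= X)%N]card_ord -card_ffun.
apply: (leq_trans _ (max_card (mem [seq exps m | m <- msupp p]))).
rewrite (card_uniqP _) // map_inj_in_uniq ?msupp_uniq // => m m' m_p m'_p.
have le_m k i : k \in msupp p -> (k i < D.+1)%N.
  move=> /msize_mdeg_lt; rewrite mdegE (bigD1 i) //=; lia.
move/ffunP => eq_mm'; apply/mnmP => i.
have := eq_mm' i; rewrite !ffunE => /(congr1 val); rewrite /= !inordK //; exact: le_m.
Qed.

Lemma meval_le n (p : {mpoly int[n]}) (v : 'I_n -> int) (D M B : nat) :
    (msize p <= D.+1)%N ->
    (forall m, (`|p@_m| <= M)%N) ->
    (forall i, (`|v i| <= 2 ^ B)%N) ->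
  (`|p.@[v]| <= D.+1 ^ n * (M * 2 ^ (B * D)))%N.
Proof.
move=> le_D coeff_le v_le; rewrite mevalE.
apply: (@leq_trans (\sum_(m <- msupp p) (M * 2 ^ (B * D)))%N).
  rewrite big_seq [X in (_ <= X)%N]big_seq.
  elim/big_ind2: _ => // [x y x' y' le1 le2|m m_p]; first by lia.
  rewrite abszM leq_mul //.
  have lt_m : (mdeg m <= D)%N.
    by rewrite -ltnS (leq_trans (msize_mdeg_lt m_p)).
  apply: (@leq_trans (2 ^ (B * mdeg m))%N); last first.
    by rewrite leq_exp2l // leq_mul2l lt_m orbT.
  rewrite mdegE big_distrr /= expn_sum.
  elim/big_ind2: _ => // [x y x' y' le1 le2|i _]; first by rewrite abszM leq_mul.
  by rewrite abszX expnM; case: (m i) => [|e] //; rewrite leq_exp2r.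
rewrite big_const_seq count_predT iter_addn_0 mulnC leq_mul2r.
by rewrite size_msupp_le ?orbT.
Qed.

Lemma poly_oracle_bitlen (R : realType) Q b : explicit Q -> subpolynomial R b ->
  exists2 K, (0 < K)%N & forall v, legal_query b v ->
    (bitlen (poly_oracle Q v) <= K * (size v).+1)%N.
Proof.
move=> [D [C [p [_ le_D le_C _]]]] /subpolynomial_linear [B le_b].
(* Explicitness speaks of n > 0, so the value at the empty query gets a constant of its own. *)
pose K0 := bitlen (Q 0%N).@[fun i : 'I_0 => [::]`_i].
exists (K0 + D.+1 + C + D + (1 + B) * D)%N; first by rewrite /K0.
move=> v leg_v; case: (posnP (size v)) => [/size0nil -> | v_gt0].
  rewrite /poly_oracle muln1 -/K0; lia.
set s := size v in v_gt0 *.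
have v_le i : (`|nth 0%R v i| <= 2 ^ (s + B))%N.
  case: (ltnP i s) => [lt_i|le_i]; last by rewrite nth_default // expn_gt0.
  apply: leq_trans (leg_v _ (mem_nth 0 lt_i)) _.
  by rewrite leq_exp2l.
have := meval_le (le_D s v_gt0) (fun m => le_C s m v_gt0) (fun i : 'I_s => v_le i).
rewrite -/(poly_oracle Q v) => le_val; apply: bitlen_le; first by lia.
apply: leq_ltn_trans le_val _.
(* Every factor is bounded by a power of 2: the number of monomials, C, s^D, and the largest value
   of a monomial. *)
apply: (@leq_ltn_trans (2 ^ (D.+1 * s + (C + D * s + (s + B) * D)))%N); last first.
  by rewrite ltn_exp2l //; nia.
rewrite (expnD 2 (D.+1 * s)) (expnD 2 (C + D * s)) (expnD 2 C).
rewrite leq_mul ?leq_mul //.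
- by rewrite expnM; case: (s) v_gt0 => // k _; rewrite leq_exp2r // ltnW // ltn_expl.
- by rewrite ltnW // ltn_expl.
by rewrite mulnC expnM; case: (D) => // k; rewrite leq_exp2r // ltnW // ltn_expl.
Qed.

(** * From satisfiability to tautology *)

(** Literals are nonzero, so the 0 after a clause marks its end unambiguously. *)
Lemma encode_clauses_inj k n n' phi phi' : kcnf k n phi -> kcnf k n' phi' ->
  encode_cnf n phi = encode_cnf n' phi' -> phi = phi'.
Proof.
move=> /andP[_ lits] /andP[_ lits'] [_].
elim: phi phi' lits lits' => [|c phi IH] [|c' phi'] //=.
- by case: c' => [|l c'].
- by case: c {IH} => [|l c].
move=> /andP[/andP[_ lits_c] lits] /andP[/andP[_ lits_c'] lits'] eq_w.
suff [-> eq_rest] : c = c' /\ flatten [seq rcons c 0 | c <- phi] =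
                              flatten [seq rcons c 0 | c <- phi'].
  by rewrite (IH phi').
move: eq_w; elim: c c' lits_c lits_c' {IH lits lits'} => [|l c IH] [|l' c'] //=.
- by move=> _ _ [].
- by move=> _ /andP[/andP[l_gt0 _] _] [l0]; rewrite -l0 in l_gt0.
- by move=> /andP[/andP[l_gt0 _] _] _ [l0]; rewrite l0 in l_gt0.
by move=> /andP[_ lits_c] /andP[_ lits_c'] [-> /(IH _ lits_c lits_c')[-> ->]].
Qed.

(** Both [yes] predicates quantify over the formulas encoded by w; unique decoding makes them
    complementary on instances. *)
Lemma answer_kTAUT k w : instance (kTAUT k) w ->
  answer (kTAUT k) w = 1 - answer (kSAT k) w.
Proof.
move=> [n [phi [cnf_phi eq_w]]]; rewrite /answer.
case: asboolP => [[n1 [phi1 [cnf1 eq1 unsat]]]|not_taut];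
  case: asboolP => [[n2 [phi2 [cnf2 eq2 sat]]]|not_sat] //.
- by case: unsat; rewrite (encode_clauses_inj cnf1 cnf2) // -eq1.
case: not_taut; exists n, phi; split=> // sat.
by case: not_sat; exists n, phi.
Qed.

(** * The time bound and the conclusion *)

Lemma linear_le_exp (R : realType) (eta : R) : 0 < eta ->
  exists2 C, 0 <= C & forall n : nat, n.+1%:R <= C * 2 `^ (eta * n%:R).
Proof.
move=> eta_gt0; have ln2_gt0 : 0 < ln (2 : R) by rewrite ln_gt0 ?ltr1n.
have eln_gt0 := mulr_gt0 eta_gt0 ln2_gt0.
(* With a = eta ln 2, the inequality e^x >= 1 + x at x = a n reduces the claim to n + 1 <= (1 + 1/a)
   (1 + a n). *)
exists (1 + (eta * ln 2)^-1).
  by rewrite addr_ge0 // invr_ge0 ltW.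
move=> n; set a := eta * ln 2 in eln_gt0 *.
have exp_ge : 1 + a * n%:R <= 2 `^ (eta * n%:R).
  apply: le_trans (expR_ge1Dx _) _.
  by rewrite /powR pnatr_eq0 /= /a [eta * n%:R * _]mulrAC.
apply: (@le_trans _ _ ((1 + a^-1) * (1 + a * n%:R))); last first.
  by rewrite ler_pM2l // addr_gt0 // invr_gt0.
have -> : (1 + a^-1) * (1 + a * n%:R) = n.+1%:R + a^-1 + a * n%:R.
  by rewrite -natr1; field; rewrite gt_eqF.
have := ler0n R n; have : 0 < a^-1 by rewrite invr_gt0.
by move=> av_gt0 n_ge0; have := mulr_ge0 (ltW eln_gt0) n_ge0; lra.
Qed.

Lemma slowdown_le (x y z j n : nat) : (x <= j + n)%N -> (0 < j)%N ->
  (200 * (100 * (y + x + z)) <= 200 * (100 * (y + j + z)) * n.+1)%N.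
Proof.
move=> x_le j_gt0; rewrite -(mulnA 200) -(mulnA 100) !leq_mul2l /=.
by rewrite mulnS; nia.
Qed.

(** The clauses of [PONTIME] with the program exposed, so that its determinism can be tracked
    separately. *)
Definition nondet_solves (R : realType) (c : R) b (t : nat -> R) Q P p : Prop :=
  (forall w g, instance P w -> exists s,
     [/\ exec (poly_oracle Q) p (init w g) s,
         in_time c t P w s,
         forall v, v \in queries s -> legal_query b v
       & result s \in [:: 0; 1] -> result s = answer P w]) /\
  (forall w, instance P w -> exists g s,
     exec (poly_oracle Q) p (init w g) s /\ result s = answer P w).

Lemma kTAUT_solved (R : realType) A (t : nat -> R) Q delta c b q del k :
    (forall n, 0 <= t n) -> explicit Q -> 0 < delta -> 0 < del delta ->
    subpolynomial R b ->
    nondet_solves c b (fun n => t n `^ (1 - delta)) Q A q ->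
    fg_reduces del (kSAT k) (fun n => 2 ^+ n) A t ->
  exists r c', deterministic r /\
    nondet_solves c' b (fun n => 2 `^ ((1 - del delta / 2) * n%:R)) Q (kTAUT k)
      (negated_compose r q).
Proof.
move=> t_ge0 exQ delta_gt0; set e := del delta => e_gt0 sub_b [sound complete] red.
have [r [d [queries_le [det_r spec]]]] := red delta delta_gt0.
have [K K_gt0 small] := poly_oracle_bitlen exQ sub_b.
have eta_gt0 : 0 < e / 2 by lra.
have [C C_ge0 le_C] := linear_le_exp eta_gt0.
pose bound v : R := `|c| * Num.max 1 (t (psize A v) `^ (1 - delta)).
pose tau v := Num.truncn (bound v).
have bound_ge0 v : 0 <= bound v.
  by rewrite mulr_ge0 // le_max ler01.
have tau_le v : (tau v)%:R <= bound v by rewrite truncn_le.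
pose W := (weight r + weight q)%N.
(* As |d| + 1 < 2^j, an integer up to (|d| + 1) 2^n has at most j + n bits; T + 1 is such an
   integer. *)
pose j := (Num.truncn (`|d| + 1)).+1.
pose G := (200 * (100 * (W + j + K)))%N.
(* With X = 2^((1 - e) n), the reduction takes |d| X; the inner runs take |c| times the number of
   queries plus the sum of the powers, each at most |d| X. *)
pose E := `|d| + 2 * `|c| * `|d|.
have q_sound w g : instance A w -> exists s,
  [/\ exec (poly_oracle Q) q (init w g) s, (clock s <= tau w)%N,
      forall v, v \in queries s -> legal_query b v
    & result s \in [:: 0; 1] -> result s = answer A w].
  move=> /(sound _ g)[s [run time leg res]]; exists s; split=> //.
  rewrite truncn_ge_nat // (le_trans time) // ler_wpM2r ?ler_norm //.
  by rewrite le_max ler01.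
have main w : instance (kTAUT k) w -> exists g1, forall g, exists s,
    [/\ exec (poly_oracle Q) (negated_compose r q) (init w g) s,
        in_time (G%:R * 2 * E * C) (fun n => 2 `^ ((1 - e / 2) * n%:R)) (kTAUT k) w s,
        forall v, v \in queries s -> legal_query b v,
        result s \in [:: 0; 1] -> result s = answer (kTAUT k) w
      & g = g1 -> result s = answer (kTAUT k) w].
  move=> inst; rewrite (answer_kTAUT inst).
  have [s [run res time [_ insts] sum_le]] := spec w (fun=> false) inst.
  have le_Wr : (weight r <= W)%N by rewrite leq_addr.
  have le_Wq : (weight q <= W)%N by rewrite leq_addl.
  have res01 : result s \in [:: 0; 1] by rewrite res answer_01.
  (* T is set to the running time of r on this very input. It belongs to the analysis only; the
     program does not depend on it. *)
  have [g1 sim] := negated_compose_correct K_gt0 small le_Wq q_sound complete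
    run det_r le_Wr (leqnn _) insts res01.
  exists g1 => g; have [s' [run' time' leg' res' luck']] := sim g.
  exists s'; rewrite -res; split=> //.
  rewrite /in_time; set n := psize _ _.
  have psize_n : psize (kSAT k) w = n by [].
  rewrite psize_n -/e in time sum_le.
  have powE : (2 ^+ n : R) `^ (1 - e) = 2 `^ ((1 - e) * n%:R).
    by rewrite -powR_mulrn // -powRrM mulrC.
  rewrite powE in time sum_le; set X := 2 `^ _ in time sum_le.
  have X_gt0 : 0 < X by rewrite powR_gt0.
  have X_le : X <= 2 ^+ n.
    by rewrite -powR_mulrn // ler_powR ?ler1n // ler_piMl //; lra.
  have time_le : (clock s)%:R <= `|d| * X.
    by rewrite (le_trans time) // ler_wpM2r ?ler_norm // ltW.
  have bits : (bitlen (clock s).+1 <= j + n)%N.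
    apply: bitlen_le; first by rewrite addn_gt0.
    rewrite -(ltr_nat R) natrX exprD -[X in X < _]natr1.
    apply: (@le_lt_trans _ _ ((`|d| + 1) * 2 ^+ n)).
      rewrite mulrDl mul1r lerD ?exprn_ege1 ?ler1n //.
      by rewrite (le_trans time_le) // ler_wpM2l.
    rewrite ltr_pM2r ?exprn_gt0 //; apply: lt_le_trans (truncnS_gt _) _.
    by rewrite -/j -natrX ler_nat ltnW // ltn_expl.
  have work_le : (work tau s)%:R <= E * X.
    have size_le : (size (queries s))%:R <= `|d| * X.
      by apply: le_trans time_le; rewrite ler_nat; have /= := exec_size_queries run; lia.
    have tau_sum : (\sum_(v <- queries s) tau v)%:R <=
        `|c| * ((size (queries s))%:R + `|d| * X).
      apply: (@le_trans _ _ (\sum_(v <- queries s)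
               `|c| * (1 + t (psize A v) `^ (1 - delta)))).
        rewrite natr_sum; apply: ler_sum => v _; apply: le_trans (tau_le v) _.
        rewrite ler_wpM2l // ge_max; have := powR_ge0 (t (psize A v)) (1 - delta).
        by move=> pow_ge0; apply/andP; split; lra.
      rewrite -mulr_sumr ler_wpM2l // big_split /= lerD //.
        by rewrite big_const_seq count_predT iter_addr addr0.
      by rewrite (le_trans sum_le) // ler_wpM2r ?ler_norm // ltW.
    rewrite /work natrD; apply: le_trans (lerD time_le tau_sum) _.
    have : `|c| * ((size (queries s))%:R + `|d| * X) <= `|c| * (`|d| * X + `|d| * X).
      by rewrite ler_wpM2l // lerD2r.
    by rewrite /E; lra.
  have : (clock s' <= G * n.+1 * (2 * work tau s))%N.
    apply: leq_trans time' _; apply: leq_mul; first exact: slowdown_le.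
    have clock_gt0 : (0 < clock s)%N := leq_ltn_trans (leq0n _) (exec_clock run).
    by rewrite mulSn mul1n leq_add2l ltn_addr.
  rewrite -(ler_nat R) => /le_trans; apply.
  have E_ge0 : 0 <= E by rewrite !addr_ge0 ?mulr_ge0.
  apply: (@le_trans _ _ (G%:R * 2 * E * C * 2 `^ ((1 - e / 2) * n%:R))); last first.
    by rewrite ler_wpM2l ?mulr_ge0 ?ler0n // le_max lexx orbT.
  have half : 2 `^ ((1 - e / 2) * n%:R) = 2 `^ ((e / 2) * n%:R) * X.
    rewrite /X -powRD; first by congr (_ `^ _); field.
    by rewrite pnatr_eq0 implybT.
  rewrite half (natrM _ (G * n.+1)) (natrM _ G) (natrM _ 2).
  have -> : G%:R * 2 * E * C * (2 `^ ((e / 2) * n%:R) * X) =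
    G%:R * (C * 2 `^ ((e / 2) * n%:R)) * (2 * (E * X)) by ring.
  rewrite ler_pM ?mulr_ge0 ?ler0n // ?ler_wpM2l ?ler0n //.
exists r, (G%:R * 2 * E * C); split=> //; split=> [w g /main[g1 /(_ g)]|w /main[g1 /(_ g1)]].
  by move=> [s [run time leg res _]]; exists s.
by move=> [s [run _ _ _ res]]; exists g1, s; split=> //; apply: res.
Qed.

Lemma deterministic_reguess O p w s g : deterministic p ->
  exec O p (init w g) s -> forall g', exec O p (init w g') (reguess s g').
Proof.
move=> det run g'; have [g1 [eq_g run']] := exec_reguess run g'.
by rewrite (eq_g det) in run'.
Qed.

(** The successful run transfers to every stream and therefore is the run at hand. *)
Lemma nondet_solves_POTIME (R : realType) (c : R) b t Q P p :
  subpolynomial R b -> deterministic p -> nondet_solves c b t Q P p ->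
  POTIME t Q P.
Proof.
move=> sub_b det [sound complete]; exists p, c, b; split=> // w g inst.
have [s [run time leg _]] := sound w g inst; exists s; split=> //.
have [g' [s' [run' <-]]] := complete w inst.
by rewrite (exec_functional run (deterministic_reguess det run' g)).
Qed.

Theorem mainTheorem5 (R : realType) (A : problem) (t : nat -> R)
    (t_ge0 : forall n, 0 <= t n) (Q : poly_family) (explicitQ : explicit Q)
    (delta : R) (delta_gt0 : 0 < delta) :
  (POTIME (fun n => t n `^ (1 - delta)) Q A ->
     POSETH R -> ~ SETH_hard t A) /\
  (PONTIME (fun n => t n `^ (1 - delta)) Q A ->
     PONSETH R -> ~ SETH_hard t A).
Proof.
split=> [[q [c [b [det_q sub_b solved]]]]|[q [c [b [sub_b sound complete]]]]] seth
  [del [del_gt0 hard]];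
  have e_gt0 : 0 < del delta / 2 by have := del_gt0 _ delta_gt0; lra.
- have [k] := seth _ Q e_gt0 explicitQ; apply.
  have solves : nondet_solves c b (fun n => t n `^ (1 - delta)) Q A q.
    split=> [w g|w] inst.
      by have [s [run time leg res]] := solved w g inst; exists s.
    by have [s [run _ _ res]] := solved w (fun=> false) inst; exists (fun=> false), s.
  have [r [c' [det_r solves']]] := kTAUT_solved t_ge0 explicitQ delta_gt0
    (del_gt0 _ delta_gt0) sub_b solves (hard k).
  apply: nondet_solves_POTIME sub_b _ solves'.
  exact: deterministic_negated_compose.
have [k] := seth _ Q e_gt0 explicitQ; apply.
have [r [c' [_ [sound' complete']]]] := kTAUT_solved t_ge0 explicitQ delta_gt0
  (del_gt0 _ delta_gt0) sub_b (conj sound complete) (hard k).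
by exists (negated_compose r q), c', b.
Qed.
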